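(* For any $\alpha<1$ there exist constants $0<\varepsilon_0<\varepsilon_1<1$ such that for any $k=k(n)\le\alpha n$, any non-adaptive $(\varepsilon_0,\varepsilon_1)$-tolerant $k$-junta tester for functions $f\colon\{0,1\}^n\to\{0,1\}$ must make $\widetilde{\Omega}(k^2)$ queries.
   Context: For $f,g\colon\{0,1\}^n\to\{0,1\}$, $\mathrm{dist}(f,g)=\Pr_{\boldsymbol x\sim\{0,1\}^n}[f(\boldsymbol x)\neq g(\boldsymbol x)]$ ($\boldsymbol x$ uniform), and for a class $\mathcal P$ of functions $\mathrm{dist}(f,\mathcal P)=\min_{g\in\mathcal P}\mathrm{dist}(f,g)$. A function is a $k$-junta if it depends on at most $k$ of its variables. An $(\varepsilon_0,\varepsilon_1)$-tolerant tester for $\mathcal P$, given black-box query access to $f$, accepts with probability at least $2/3$ if $\mathrm{dist}(f,\mathcal P)\le\varepsilon_0$ and rejects with probability at least $2/3$ if $\mathrm{dist}(f,\mathcal P)>\varepsilon_1$. Non-adaptive means all queries are chosen before any answers are seen. $\widetilde{\Omega}(f)$ means $\Omega(f/\log^c f)$ for an absolute constant $c$. *)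

(* Defs.v *)
From mathcomp Require Import all_boot all_order all_algebra.
From mathcomp Require Import reals exp.
Set Implicit Arguments.
Unset Strict Implicit.
Unset Printing Implicit Defensive.
Import Order.TTheory GRing.Theory Num.Theory.
Local Open Scope ring_scope.

Definition cube (n : nat) : finType := {ffun 'I_n -> bool}.

Definition boolfun (n : nat) : finType := {ffun cube n -> bool}.

Definition dist (R : realType) (n : nat) (f g : boolfun n) : R :=
  #|[set x : cube n | f x != g x]|%:R / #|cube n|%:R.

(* Distances never exceed 1, so the neutral value 1 does not affect the minimum
   over a nonempty class. *)
Definition dist_class (R : realType) (n : nat) (f : boolfun n)
    (P : {set boolfun n}) : R :=
  \big[Num.min/1]_(g in P) dist R f g.

Definition flip (n : nat) (i : 'I_n) (x : cube n) : cube n :=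
  [ffun j => if j == i then ~~ x j else x j].

Definition depends_on (n : nat) (f : boolfun n) (i : 'I_n) : bool :=
  [exists x : cube n, f (flip i x) != f x].

Definition juntas (n k : nat) : {set boolfun n} :=
  [set f : boolfun n | (#|[set i : 'I_n | depends_on f i]| <= k)%N].

(* A randomized non-adaptive algorithm making (at most, by repeating a query)
   q queries: all queries are a function of the random seed alone, and the
   verdict is a function of the seed and of the q answers. A finite seed space
   with arbitrary real weights loses no generality, since for fixed n and q
   there are only finitely many deterministic non-adaptive algorithms. *)
Record nonadaptive_tester (R : realType) (n q : nat) := NonadaptiveTester {
  seed : finType;
  seed_pr : seed -> R;
  seed_pr_ge0 : forall s, 0 <= seed_pr s;
  seed_pr_sum1 : \sum_s seed_pr s = 1;
  queries : seed -> q.-tuple (cube n);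
  verdict : seed -> q.-tuple bool -> bool
}.

Definition accepts (R : realType) (n q : nat) (T : nonadaptive_tester R n q)
    (f : boolfun n) (s : seed T) : bool :=
  verdict s (map_tuple f (queries s)).

Definition accept_pr (R : realType) (n q : nat) (T : nonadaptive_tester R n q)
    (f : boolfun n) : R :=
  \sum_(s : seed T | accepts f s) seed_pr s.

Definition reject_pr (R : realType) (n q : nat) (T : nonadaptive_tester R n q)
    (f : boolfun n) : R :=
  \sum_(s : seed T | ~~ accepts f s) seed_pr s.

Definition is_tolerant_tester (R : realType) (n q : nat) (eps0 eps1 : R)
    (P : {set boolfun n}) (T : nonadaptive_tester R n q) : Prop :=
  forall f : boolfun n,
    (dist_class R f P <= eps0 -> 2%:R / 3%:R <= accept_pr T f) /\
    (eps1 < dist_class R f P -> 2%:R / 3%:R <= reject_pr T f).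

(* x / log^c x, the rate in soft-Omega bounds. The truncation of the logarithm
   at 1 only keeps the denominator positive when x is small; it is inactive for
   x >= exp 1, in particular for x = k ^ 2 with k >= 2. *)
Definition over_polylog (R : realType) (c : nat) (x : R) : R :=
  x / (Num.max 1 (ln x)) ^+ c.

(* Main.v *)
Require Import Defs.
From mathcomp Require Import all_boot all_order all_algebra.
From mathcomp Require Import reals exp.
From mathcomp Require Import zify ring lra.
Set Implicit Arguments.
Unset Strict Implicit.
Unset Printing Implicit Defensive.
Import Order.TTheory GRing.Theory Num.Theory.
Local Open Scope ring_scope.
Local Notation expR := sequences.expR.

(** Split most of the coordinates into [h] blocks of [B] pairs each. A random pair
    of every block is "active" and all other coordinates of the blocks are
    "control"; the control part of [x] selects a random gate, that is, the XOR of
    two active coordinates and a random bit. Each active pair has one coordinate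
    on either of two sides, chosen by a random sign. In the YES distribution the
    two inputs of a gate lie on the same side, in the NO distribution on opposite
    sides. Forgetting the worse side makes a YES function 1/4-close to a junta. A
    junta on [k], about (2B-1)h, coordinates either forgets many control
    coordinates, which decorrelates it from a NO function, or forgets about half
    of the active ones, and then about 3/4 of the NO gates read a forgotten input.

    Queries falling in one control cell differ in few blocks, for otherwise the
    random choice of the active pairs separates them. A gate can be informative
    only if both its inputs lie in the set L_z of blocks on which the queries of
    its cell z disagree. Expanding the likelihoods in the random signs, the two
    acceptance probabilities differ by at most
      2 (E prod_z (1 + (sum_(b in L_z) sigma_b)^2 / h^2) - 1),
    and the exponent (1/h^2) sum_z (sum_(b in L_z) sigma_b)^2 has mean
    sum_z |L_z| / h^2 = O(q log k / k^2) and subexponential tails. *)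

(** * Product measures and signs *)

(** The coordinates of [G] are independent under the product of [mu], so factors separate according
    to the coordinate they read. *)
Lemma sum_ffun_prod_keyed (R : comPzRingType) (Z D : finType) (T : Type)
    (mu : D -> R) (key : T -> Z) (phi : T -> D -> R) (s : seq T) :
  \sum_(G : {ffun Z -> D})
     (\prod_z mu (G z)) * (\prod_(x <- s) phi x (G (key x))) =
  \prod_z \sum_d mu d * \prod_(x <- s | key x == z) phi x d.
Proof.
rewrite bigA_distr_bigA; apply: eq_bigr => G _; rewrite big_split; congr (_ * _).
rewrite (exchange_big_dep xpredT) //=; apply: eq_bigr => x _.
by rewrite (big_pred1 (key x)) // => z; rewrite eq_sym.
Qed.

Lemma sum_ffun_prod (R : comPzRingType) (Z D : finType) (mu : D -> R) :
  \sum_d mu d = 1 -> \sum_(G : {ffun Z -> D}) \prod_z mu (G z) = 1.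
Proof.
move=> mu1; rewrite -(bigA_distr_bigA (fun (z : Z) d => mu d)).
by rewrite big1 // => z _.
Qed.

(* Fiberwise equal weights cannot be told apart through [pi]. *)
Lemma sum_ffun_prod_fiber (R : comPzRingType) (Z D E : finType)
    (pi : Z -> D -> E) (w v : Z -> D -> R) (Phi : {ffun Z -> E} -> R) :
  (forall z e, \sum_(d | pi z d == e) w z d = \sum_(d | pi z d == e) v z d) ->
  \sum_(G : {ffun Z -> D}) (\prod_z w z (G z)) * Phi [ffun z => pi z (G z)] =
  \sum_(G : {ffun Z -> D}) (\prod_z v z (G z)) * Phi [ffun z => pi z (G z)].
Proof.
move=> wv.
have key u : \sum_(G : {ffun Z -> D})
      (\prod_z u z (G z)) * Phi [ffun z => pi z (G z)] =
    \sum_(r : {ffun Z -> E}) (\prod_z \sum_(d | pi z d == r z) u z d) * Phi r.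
  rewrite (partition_big (fun G : {ffun Z -> D} => [ffun z => pi z (G z)]) xpredT) //=.
  apply: eq_bigr => r _; rewrite bigA_distr_big_dep mulr_suml.
  apply: eq_big => [G|G /eqP -> //].
  apply/eqP/familyP => [<- z|eG]; first by rewrite ffunE unfold_in /=.
  by apply/ffunP => z; rewrite ffunE; apply/eqP; exact: eG.
by rewrite !key; apply: eq_bigr => r _; congr (_ * _); apply: eq_bigr.
Qed.

(** Chebyshev's inequality: in the expanded square of the sum only near pairs contribute, each at
    most 1, so the second moment is at most [kappa] times |X|^2. *)
Lemma chebyshev_sparse (R : realFieldType) (X Om : finType) (w : Om -> R)
    (Z : X -> Om -> R) (near : rel X) (kappa eps : R) :
  (0 < #|X|)%N -> (forall o, 0 <= w o) -> \sum_o w o = 1 ->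
  (forall x o, `|Z x o| <= 1) ->
  (forall x y, ~~ near x y -> \sum_o w o * (Z x o * Z y o) = 0) ->
  (forall x, #|[set y | near x y]|%:R <= kappa * #|X|%:R) -> 0 < eps ->
  \sum_(o | eps * #|X|%:R <= `|\sum_x Z x o|) w o <= kappa / eps ^+ 2.
Proof.
move=> X0 w0 w1 Z1 far nearK eps0.
set N : R := #|X|%:R; have N0 : 0 < N by rewrite ltr0n.
have second : \sum_o w o * (\sum_x Z x o) ^+ 2 <= kappa * N ^+ 2.
  have -> : \sum_o w o * (\sum_x Z x o) ^+ 2 =
      \sum_x \sum_y \sum_o w o * (Z x o * Z y o).
    transitivity (\sum_o \sum_x \sum_y w o * (Z x o * Z y o)).
      apply: eq_bigr => o _; rewrite expr2 mulr_suml mulr_sumr.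
      by apply: eq_bigr => x _; rewrite mulr_sumr mulr_sumr.
    by rewrite exchange_big; apply: eq_bigr => x _; rewrite exchange_big.
  have -> : kappa * N ^+ 2 = \sum_(x : X) kappa * N.
    by rewrite sumr_const -mulr_natr expr2 mulrA.
  apply: ler_sum => x _; apply: le_trans (nearK x).
  rewrite (bigID (near x)) /= [X in _ + X]big1 ?addr0; last by move=> y /far.
  apply: (@le_trans _ _ (\sum_(y | near x y) 1)).
    apply: ler_sum => y _; rewrite -w1; apply: ler_sum => o _.
    rewrite -[leRHS]mulr1; apply: ler_wpM2l => //.
    by apply: le_trans (ler_norm _) _; rewrite normrM mulr_ile1.
  by rewrite sumr_const -cardsE.
rewrite ler_pdivlMr ?exprn_gt0 // -(ler_pM2r (exprn_gt0 2 N0)).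
apply: le_trans second; rewrite -mulrA -exprMn mulr_suml.
rewrite [leRHS](bigID (fun o => eps * N <= `|\sum_x Z x o|)) /=.
apply: ler_wpDr; first by apply: sumr_ge0 => o _; rewrite mulr_ge0 // sqr_ge0.
apply: ler_sum => o le_o; apply: ler_wpM2l => //.
rewrite -[leRHS]real_normK ?num_real //.
by rewrite ler_pXn2r // ?nnegrE ?normr_ge0 // mulr_ge0 // ltW.
Qed.

Lemma card_set_family (I J : finType) (F : I -> pred J) :
  #|[set f : {ffun I -> J} | [forall i, f i \in F i]]| = (\prod_i #|F i|)%N.
Proof.
have -> : (\prod_i #|F i|)%N = foldr muln 1%N [seq #|F x| | x : I].
  by rewrite foldrE big_map big_enum.
rewrite -(card_family (fun i => F i)); apply: eq_card => f.
by rewrite inE; apply/forallP/familyP.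
Qed.

Lemma expR_le_invB (R : realType) (y : R) : y < 1 -> expR y <= (1 - y)^-1.
Proof.
move=> y1; have := expR_ge1Dx (- y); rewrite expRN => le1.
by rewrite -[expR y]invrK lef_pV2 // posrE ?invr_gt0 ?expR_gt0 // subr_gt0.
Qed.

(** The constant 2 allows a proof from 1 + y <= exp y alone: for small x the average of 1/(1 - x)
    and 1/(1 + x) is 1/(1 - x^2) <= 1 + 2x^2, and for large x both exponents are at most 2x^2. *)
Lemma cosh_le_expR (R : realType) (x : R) :
  (expR x + expR (- x)) / 2 <= expR (2 * x ^+ 2).
Proof.
have [x1|x1] := lerP (x ^+ 2) (1 / 2).
  have x12 : -1 < x < 1 by apply/andP; split; nra.
  have /andP[xm xp] := x12.
  have e1 := expR_le_invB xp.
  have e2 : expR (- x) <= (1 - - x)^-1 by apply: expR_le_invB; lra.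
  apply: le_trans (expR_ge1Dx _).
  apply: (@le_trans _ _ (((1 - x)^-1 + (1 - - x)^-1) / 2)).
    by rewrite ler_pM2r ?invr_gt0 //; exact: lerD.
  have -> : ((1 - x)^-1 + (1 - - x)^-1) / 2 = (1 - x ^+ 2)^-1.
    by field; apply/and3P; split; apply: lt0r_neq0; nra.
  by rewrite -[leLHS]mul1r ler_pdivrMr; nra.
have ub (y : R) : y ^+ 2 = x ^+ 2 -> expR y <= expR (2 * x ^+ 2).
  by move=> yx; rewrite ler_expR; nra.
have := ub x erefl; have := ub (- x) (sqrrN _); lra.
Qed.

(** The tangent line of exp at the mean [m] lies below exp, and its average is exp m. *)
Lemma expR_jensen (R : realType) (I : finType) (p a : I -> R) :
  (forall i, 0 <= p i) -> \sum_i p i = 1 ->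
  expR (\sum_i p i * a i) <= \sum_i p i * expR (a i).
Proof.
move=> p0 p1; set m := \sum_i _.
apply: (@le_trans _ _ (\sum_i p i * (expR m * (1 + (a i - m))))).
  have -> : \sum_i p i * (expR m * (1 + (a i - m))) =
      expR m * ((\sum_i p i) * (1 - m) + \sum_i p i * a i).
    rewrite mulr_suml -big_split mulr_sumr; apply: eq_bigr => i _ /=; ring.
  by rewrite p1 -/m mul1r subrK mulr1.
apply: ler_sum => i _; apply: ler_wpM2l => //.
rewrite -[in leRHS](subrK m (a i)) [a i - m + m]addrC expRD.
by rewrite ler_pM2l ?expR_gt0 // expR_ge1Dx.
Qed.

Lemma sum_union_le (R : realFieldType) (I Om : finType) (w : Om -> R)
    (P : pred Om) (A : I -> pred Om) :
  (forall o, 0 <= w o) -> (forall o, P o -> exists i, A i o) ->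
  \sum_(o | P o) w o <= \sum_i \sum_(o | A i o) w o.
Proof.
move=> w0 PA; rewrite (exchange_big_dep xpredT) //= big_mkcond /=.
apply: ler_sum => o _; case: ifP => [/PA[i Ai]|_]; last exact: sumr_ge0.
by rewrite (bigD1 i) //= lerDl; exact: sumr_ge0.
Qed.

(** The sum factors over [T], with factor 2 or 0 according to the parity of the multiplicity in
    [s]. *)
Lemma sum_sign_monomial_ge0 (R : realFieldType) (T : finType) (s : seq T) :
  0 <= \sum_(sg : {ffun T -> bool}) \prod_(b <- s) (-1) ^+ sg b :> R.
Proof.
have := sum_ffun_prod_keyed (fun _ : bool => 1 : R) (@id T)
  (fun _ t => (-1) ^+ t) s.
rewrite (eq_bigr (fun sg : {ffun T -> bool} => \prod_(b <- s) (-1) ^+ sg b));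
  last by move=> sg _; rewrite big1 // mul1r.
move=> ->; apply: prodr_ge0 => z _.
rewrite big_bool /= !mul1r expr1 expr0 big1_eq big_const_seq iter_mulr_1.
by rewrite -signr_odd; case: (odd _); rewrite ?expr1 ?addNr ?expr0 ?addr_ge0.
Qed.

(* Averaging over one sign turns [s] into at most [s + 8 s^2], so [s] stays below
   [S] along the induction. *)
Lemma sum_expR_sqr_sign (R : realType) (T : finType) (l : seq T) (s S : R) :
  uniq l -> 0 <= s -> s + 8 * S ^+ 2 * (size l)%:R <= S ->
  \sum_(sg : {ffun T -> bool}) expR (s * (\sum_(b <- l) (-1) ^+ sg b) ^+ 2) <=
  #|{ffun T -> bool}|%:R * expR (S * (size l)%:R).
Proof.
elim: l s => [|b0 l IH] s /=.
  move=> _ _ _; under eq_bigr do rewrite big_nil expr0n mulr0 expR0.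
  by rewrite sumr_const mulr0 expR0 mulr1.
move=> /andP[b0l ul] s0 sS.
have sleS : s <= S.
  by apply: le_trans sS; rewrite lerDl mulr_ge0 // mulr_ge0 // sqr_ge0.
pose fl (sg : {ffun T -> bool}) : {ffun T -> bool} := [ffun b => (b == b0) (+) sg b].
have flK : involutive fl by move=> sg; apply/ffunP => b; rewrite !ffunE addKb.
pose f sg := expR (s * (\sum_(b <- b0 :: l) (-1) ^+ (sg : {ffun T -> bool}) b) ^+ 2).
pose Y (sg : {ffun T -> bool}) : R := \sum_(b <- l) (-1) ^+ sg b.
have Yfl sg : Y (fl sg) = Y sg.
  apply: eq_big_seq => b bl; rewrite ffunE.
  by case: eqP => [bb|//]; rewrite -bb bl in b0l.
have step sg : f sg + f (fl sg) <= 2 * (expR s * expR ((s + 8 * s ^+ 2) * Y sg ^+ 2)).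
  rewrite /f !big_cons -!/(Y _) Yfl ffunE eqxx /= signrN.
  set e : R := (-1) ^+ sg b0; set y := Y sg.
  have e2 : e ^+ 2 = 1 by rewrite sqrr_sign.
  have E c : c ^+ 2 = 1 -> expR (s * (c + y) ^+ 2) =
      expR (s + s * y ^+ 2) * expR (2 * s * c * y).
    move=> c2; rewrite -expRD; congr expR.
    by rewrite sqrrD c2; ring.
  rewrite !E ?sqrrN // -mulrDr.
  have -> : 2 * s * - e * y = - (2 * s * e * y) by ring.
  have := cosh_le_expR (2 * s * e * y).
  have -> : 2 * (2 * s * e * y) ^+ 2 = 8 * s ^+ 2 * y ^+ 2.
    by rewrite !exprMn e2; ring.
  have -> : 2 * (expR s * expR ((s + 8 * s ^+ 2) * y ^+ 2)) =
      expR (s + s * y ^+ 2) * (2 * expR (8 * s ^+ 2 * y ^+ 2)).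
    by rewrite [(s + _) * _]mulrDl !expRD; ring.
  by move=> ch; rewrite ler_pM2l ?expR_gt0 //; lra.
have -> : \sum_sg f sg = (\sum_sg (f sg + f (fl sg))) / 2.
  rewrite big_split /=.
  have <- : \sum_sg f sg = \sum_sg f (fl sg) by exact: (reindex_inj (inv_inj flK)).
  by rewrite -mulr2n -[X in X / 2]mulr_natr mulfK // pnatr_eq0.
apply: (@le_trans _ _ (\sum_sg (expR s * expR ((s + 8 * s ^+ 2) * Y sg ^+ 2)))).
  rewrite ler_pdivrMr // mulrC mulr_sumr; apply: ler_sum => sg _; exact: step.
rewrite -mulr_sumr.
have s2 : s ^+ 2 <= S ^+ 2 by rewrite ler_pXn2r // nnegrE // (le_trans s0).
have IHs := IH (s + 8 * s ^+ 2) ul _ _.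
rewrite -(natr1 (size l)) in sS *.
apply: (@le_trans _ _ (expR s * (#|{ffun T -> bool}|%:R * expR (S * (size l)%:R)))).
  rewrite ler_pM2l ?expR_gt0 //; apply: IHs.
    by rewrite addr_ge0 // mulr_ge0 // sqr_ge0.
  by have := sqr_ge0 s; lra.
rewrite mulrDr mulr1 expRD mulrCA ler_wpM2l ?ler0n // mulrC.
by rewrite ler_pM2l ?expR_gt0 // ler_expR.
Qed.

(** The factors are dependent through the common signs; after 1 + y <= exp y, Jensen's inequality
    with weights |L z| / tot reduces the product to a single z at a time. *)
Lemma sum_prod_sign_le (R : realType) (Z T : finType) (L : Z -> {set T})
    (h eta : R) :
  0 < h -> \sum_z #|L z|%:R <= eta * h ^+ 2 -> 32 * eta <= 1 ->
  \sum_(sg : {ffun T -> bool})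
     \prod_z (1 + (\sum_(b in L z) (-1) ^+ sg b / h) ^+ 2) <=
  #|{ffun T -> bool}|%:R * expR (2 * eta).
Proof.
move=> h0 totle eta1; set tot : R := \sum_z _ in totle.
have h2 : 0 < h ^+ 2 by rewrite exprn_gt0.
have tot0 : 0 <= tot by apply: sumr_ge0.
have le_eta : tot / h ^+ 2 <= eta by rewrite ler_pdivrMr.
have eta0 : 0 <= eta by apply: le_trans le_eta; rewrite divr_ge0 // ltW.
pose Y (sg : {ffun T -> bool}) z : R := \sum_(b in L z) (-1) ^+ sg b.
have [tot_eq0|tot_neq0] := eqVneq tot 0.
  have L0 z : L z = set0.
    apply/eqP; rewrite -cards_eq0 -(pnatr_eq0 R).
    by move/eqP: tot_eq0; rewrite psumr_eq0 // => /allP/(_ z (mem_index_enum _)).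
  rewrite (eq_bigr (fun=> 1)) ?sumr_const; last first.
    by move=> sg _; rewrite big1 // => z _; rewrite L0 big_set0 expr0n addr0.
  rewrite ler_peMr ?ler0n //; apply: le_trans (expR_ge1Dx _).
  by rewrite lerDl mulr_ge0.
have tot_gt0 : 0 < tot by rewrite lt_neqAle eq_sym tot_neq0.
pose p z : R := #|L z|%:R / tot.
pose a sg z : R := tot / (#|L z|%:R * h ^+ 2) * Y sg z ^+ 2.
have p0 z : 0 <= p z by rewrite divr_ge0.
have p1 : \sum_z p z = 1 by rewrite -mulr_suml divff.
apply: (@le_trans _ _ (\sum_(sg : {ffun T -> bool}) \sum_z p z * expR (a sg z))).
  apply: ler_sum => sg _; apply: le_trans (expR_jensen _ p0 p1).
  rewrite expR_sum; apply: ler_prod => z _.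
  rewrite -mulr_suml -/(Y sg z) addr_ge0 ?sqr_ge0 //=.
  apply: le_trans (expR_ge1Dx _) _; rewrite ler_expR /p /a.
  have [L0|L0] := eqVneq (L z) set0; first by rewrite /Y L0 big_set0 cards0 !mul0r expr0n.
  have L0' : #|L z|%:R != 0 :> R by rewrite pnatr_eq0 cards_eq0.
  rewrite le_eqVlt; apply/orP; left; apply/eqP; field.
  by rewrite L0' tot_neq0 (gt_eqF h0).
rewrite exchange_big /=.
have -> : #|{ffun T -> bool}|%:R * expR (2 * eta) =
    \sum_z p z * (#|{ffun T -> bool}|%:R * expR (2 * eta)).
  by rewrite -mulr_suml p1 mul1r.
apply: ler_sum => z _; rewrite -mulr_sumr.
have [L0|L0] := eqVneq (L z) set0; first by rewrite /p L0 cards0 !mul0r.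
apply: ler_wpM2l => //.
have l0 : 0 < #|L z|%:R :> R by rewrite ltr0n card_gt0.
set s := tot / (#|L z|%:R * h ^+ 2).
have sl : s * #|L z|%:R = tot / h ^+ 2.
  by rewrite /s; field; rewrite (gt_eqF l0) (gt_eqF h0).
have s0 : 0 <= s by rewrite divr_ge0 // mulr_ge0 // ltW.
(* With S = 2s the premise s + 8 S^2 |L z| <= S becomes 32 s |L z| <= 1, which holds as s |L z| =
   tot / h^2 <= eta. *)
have := @sum_expR_sqr_sign R T (enum (L z)) s (2 * s) (enum_uniq _) s0.
rewrite -cardE => mgf; apply: (@le_trans _ _ (#|{ffun T -> bool}|%:R * expR (2 * s * #|L z|%:R))).
  apply: le_trans (mgf _); last by nra.
  by apply: ler_sum => sg _; rewrite big_enum.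
by rewrite ler_wpM2l // ler_expR -mulrA sl ler_pM2l.
Qed.

(* Only the parity of a monomial in independent signs matters for its mean,
   which is 0 or 1; so the means of the expanded products are dominated termwise
   by those with the coefficients replaced by their absolute values. *)
Lemma sum_sign_prod_diff (R : realFieldType) (Z T : finType) (b1 b2 : Z -> T)
    (k : Z -> R) (m : {ffun T -> bool} -> Z -> R) :
  (forall sg z, m sg z = (-1) ^+ sg (b1 z) * (-1) ^+ sg (b2 z)) ->
  `|\sum_sg (\prod_z (1 + k z * m sg z) - \prod_z (1 - k z * m sg z))| <=
  2 * (\sum_sg \prod_z (1 + `|k z| * m sg z) - #|{ffun T -> bool}|%:R).
Proof.
move=> mE.
pose M (J : {set Z}) := \sum_sg \prod_(z in J) m sg z.
have M0 J : 0 <= M J.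
  have := sum_sign_monomial_ge0 R ([seq b1 z | z <- enum J] ++ [seq b2 z | z <- enum J]).
  rewrite (eq_bigr (fun sg => \prod_(z in J) m sg z)) // => sg _.
  rewrite big_cat !big_map !big_enum /= -big_split /=.
  by apply: eq_bigr => z _; rewrite mE.
have expand (a : Z -> R) : \sum_sg \prod_z (1 + a z * m sg z) =
    \sum_(J : {set Z}) (\prod_(z in J) a z) * M J.
  transitivity (\sum_sg \sum_(J : {set Z}) (\prod_(z in J) a z) * \prod_(z in J) m sg z).
    apply: eq_bigr => sg _; rewrite (eq_bigr (fun z => a z * m sg z + 1)); last first.
      by move=> z _; rewrite addrC.
    rewrite bigA_distr; apply: eq_big => // J _.
    by rewrite -big_split [RHS]big_mkcond.
  by rewrite exchange_big; apply: eq_bigr => J _; rewrite mulr_sumr.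
rewrite sumrB expand (eq_bigr (fun sg => \prod_z (1 + (- k z) * m sg z))); last first.
  by move=> sg _; apply: eq_bigr => z _; rewrite mulNr.
rewrite !expand -sumrB (bigD1 set0) //= !big_set0 subrr add0r.
rewrite [in leRHS](bigD1 set0) //= big_set0 mul1r.
have -> : M set0 = #|{ffun T -> bool}|%:R.
  rewrite /M (eq_bigr (fun=> 1)) ?sumr_const // => sg _; exact: big_set0.
rewrite addrC addrK mulr_sumr; apply: le_trans (ler_norm_sum _ _ _) _.
apply: ler_sum => J _; rewrite -mulrBl normrM (ger0_norm (M0 J)) mulrA.
apply: ler_wpM2r => //; apply: le_trans (ler_normB _ _) _.
rewrite !normr_prod mulr_natl mulr2n lerD2l.
by rewrite (eq_bigr (fun z => `|k z|)) // => z _; rewrite normrN.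
Qed.


(** * The hard functions and their distance to juntas *)

Lemma flip_involutive n (i : 'I_n) : involutive (flip i).
Proof. by move=> x; apply/ffunP => j; rewrite !ffunE; case: eqP; rewrite ?negbK. Qed.

Lemma flip_eq n (i : 'I_n) (x : cube n) : flip i x i = ~~ x i.
Proof. by rewrite ffunE eqxx. Qed.

Lemma flip_neq n (i j : 'I_n) (x : cube n) : j != i -> flip i x j = x j.
Proof. by move=> ji; rewrite ffunE (negPf ji). Qed.

Lemma flip_indep n (f : boolfun n) (i : 'I_n) x :
  ~~ depends_on f i -> f (flip i x) = f x.
Proof. by move=> /existsPn/(_ x); rewrite negbK => /eqP. Qed.

Lemma card_cube n : #|cube n| = (2 ^ n)%N.
Proof. by rewrite card_ffun card_bool card_ord. Qed.

Lemma dist_class_le (R : realType) n (f g : boolfun n) (P : {set boolfun n}) :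
  g \in P -> dist_class R f P <= dist R f g.
Proof. by move=> gP; exact: bigmin_le_cond. Qed.

Lemma lt_dist_class (R : realType) n (f : boolfun n) (P : {set boolfun n}) e :
  e < 1 -> (forall g, g \in P -> e < dist R f g) -> e < dist_class R f P.
Proof. by move=> e1 eP; apply: lt_bigmin => // g; apply: eP. Qed.

Lemma gt_distE (R : realType) n (f g : boolfun n) (e : R) :
  (e < dist R f g) = (e * #|cube n|%:R < #|[set x | f x != g x]|%:R).
Proof. by rewrite ltr_pdivlMr // ltr0n card_cube expn_gt0. Qed.

Lemma accept_reject (R : realType) n q (T : nonadaptive_tester R n q) f :
  accept_pr T f + reject_pr T f = 1.
Proof. by rewrite -(seed_pr_sum1 T) [RHS](bigID (accepts f)). Qed.

(* Each orbit {x, phi x} inside H contains a point where f and g disagree. *)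
Lemma card_mismatch_involution n (f g : boolfun n) (H : {set cube n})
    (phi : cube n -> cube n) :
  {in H, forall x, phi x \in H} -> {in H, forall x, phi (phi x) = x} ->
  {in H, forall x, f (phi x) = ~~ f x} -> {in H, forall x, g (phi x) = g x} ->
  (#|H| <= 2 * #|[set x | f x != g x]|)%N.
Proof.
move=> phiH phiK fphi gphi; set M := [set x | _].
have HM : H \subset M :|: [set phi x | x in M :&: H].
  apply/subsetP => x xH; rewrite !inE; case: (boolP (f x != g x)) => //= fg.
  apply/imsetP; exists (phi x); last by rewrite phiK.
  by rewrite !inE fphi // gphi // phiH // andbT; move: fg; case: (f x); case: (g x).
apply: leq_trans (subset_leq_card HM) _; rewrite mul2n -addnn.
apply: leq_trans (leq_card_setU _ _) _; rewrite leq_add2l.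
by apply: leq_trans (leq_imset_card _ _) _; rewrite subset_leq_card ?subsetIl.
Qed.

Section HardFunctions.
Variables (n : nat) (Bl Ch : finType) (var : Bl * Ch * bool -> 'I_n).
Hypothesis var_inj : injective var.
Implicit Types (w : {ffun Bl -> Ch}) (s : {ffun Bl -> bool}) (u : Bl * bool).

(** Inputs are named by block and position within the active pair, so a gate makes sense for every
    choice [w]; the last component is the random bit. *)
Definition gate : finType := ((Bl * bool) * (Bl * bool) * bool)%type.
Implicit Types (G : {ffun cube n -> gate}) (d : gate).

(* [w] selects the active pair of each block: [avar] is an active coordinate and
   [ctrl] the set of control ones. Coordinates outside the range of [var] are
   irrelevant, and [key] masks them out together with the active ones. *)
Definition avar w u : 'I_n := var (u.1, w u.1, u.2).
Definition ctrl w : {set 'I_n} := var @: [set p | p.1.2 != w p.1.1].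
Definition key w (x : cube n) : cube n := [ffun i => (i \in ctrl w) && x i].
Definition gate_val w d (x : cube n) : bool :=
  d.2 (+) (x (avar w d.1.1) (+) x (avar w d.1.2)).
Definition hardfun w G : boolfun n := [ffun x => gate_val w (G (key w x)) x].
Definition side s u : bool := u.2 (+) s u.1.

Lemma avar_inj w : injective (avar w).
Proof. by move=> [b t] [b' t'] /var_inj [-> _ ->]. Qed.

Lemma avar_notin_ctrl w u : avar w u \notin ctrl w.
Proof.
apply/imsetP => -[[[b c] t]]; rewrite inE /= => cw /var_inj [eb ec _].
by rewrite -eb ec eqxx in cw.
Qed.

Lemma key_flip w i x : i \notin ctrl w -> key w (flip i x) = key w x.
Proof.
move=> iw; apply/ffunP => j; rewrite !ffunE.
by case: eqP => [->|//]; rewrite (negPf iw).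
Qed.

Lemma card_ctrl w : (#|ctrl w| + 2 * #|Bl| = 2 * #|Ch| * #|Bl|)%N.
Proof.
rewrite card_imset //.
have -> : (2 * #|Bl| = #|[set p : Bl * Ch * bool | p.1.2 == w p.1.1]|)%N.
  have -> : [set p : Bl * Ch * bool | p.1.2 == w p.1.1] =
      [set (u.1, w u.1, u.2) | u : Bl * bool].
    apply/setP => -[[b c] t]; rewrite inE /=.
    apply/eqP/imsetP => [->|[u _ [-> -> _]] //]; by exists (b, t).
  rewrite card_imset; last by move=> [b t] [b' t'] [-> _ ->].
  by rewrite card_prod card_bool mulnC.
rewrite addnC; have -> : [set p : Bl * Ch * bool | p.1.2 != w p.1.1] =
    ~: [set p | p.1.2 == w p.1.1] by apply/setP => p; rewrite !inE.
by rewrite cardsC !card_prod card_bool; lia.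
Qed.

Lemma card_side s e : #|[set u | side s u == e]| = #|Bl|.
Proof.
have -> : [set u | side s u == e] = [set (b, e (+) s b) | b : Bl].
  apply/setP => -[b t]; rewrite inE /side /=.
  apply/eqP/imsetP => [<-|[b' _ [-> ->]]]; last by rewrite addbK.
  by exists b => //; rewrite addbK.
by rewrite card_imset // => b b' [].
Qed.

Lemma card_key_fiber w z :
  (#|[set y | key w y == z]| * 2 ^ #|ctrl w| <= #|cube n|)%N.
Proof.
pose F i : pred bool := if i \in ctrl w then pred1 (z i) else predT.
have sub : [set y | key w y == z] \subset [set f : cube n | [forall i, f i \in F i]].
  apply/subsetP => y; rewrite !inE => /eqP zE; apply/forallP => i.
  by rewrite /F -zE ffunE; case: (i \in ctrl w) => //; rewrite !inE.
apply: leq_trans (leq_mul (subset_leq_card sub) (leqnn _)) _.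
rewrite card_set_family -prod_nat_const [X in (_ * X)%N]big_mkcond -big_split /=.
rewrite (eq_bigr (fun=> 2%N)) ?prod_nat_const ?card_ord ?card_cube // => i _.
by rewrite /F; case: (i \in ctrl w); rewrite ?card1 // cardT enumT unlock.
Qed.

(* Among the four juntas that output a constant shift [c] of the gate bit on the
   gates of side [e], every point is a mismatch of exactly one. *)
Lemma hard_same_side_close (R : realType) w s G k :
  (forall z, side s (G z).1.1 = side s (G z).1.2) ->
  (2 * #|Ch| * #|Bl| <= k + #|Bl|)%N ->
  dist_class R (hardfun w G) (juntas n k) <= 1 / 4.
Proof.
move=> same hk.
pose cand (p : bool * bool) : boolfun n := [ffun x => let d := G (key w x) in
  if side s d.1.1 == p.1 then p.2 (+) d.2 else gate_val w d x].
pose mis p := #|[set x | hardfun w G x != cand p x]|.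
have candJ p : cand p \in juntas n k.
  rewrite inE; set D := [set i | _].
  (* Gates on side [p.1] are answered without their inputs; the others have both inputs on the other
     side, so only half of the active coordinates are read. *)
  have sub : D \subset ctrl w :|: [set avar w u | u in [set u | side s u == ~~ p.1]].
    apply/subsetP => i; rewrite inE; apply: contraLR; rewrite in_setU negb_or.
    move=> /andP[iw iA]; apply/existsPn => x; rewrite negbK !ffunE key_flip //=.
    case: (eqVneq (side s (G (key w x)).1.1) p.1) => // sp.
    have notA u : side s u != p.1 -> flip i x (avar w u) = x (avar w u).
      move=> su; apply: flip_neq; apply: contraNneq iA => <-.
      by apply: imset_f; rewrite inE; move: su; case: (side s u); case: p.1.
    by rewrite /gate_val !notA // -same.
  apply: leq_trans (subset_leq_card sub) _.
  apply: leq_trans (leq_card_setU _ _) _.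
  rewrite card_imset ?card_side; last exact: avar_inj.
  by rewrite -(leq_add2r #|Bl|) -addnA addnn -mul2n card_ctrl.
have mis_sum : (\sum_p mis p = #|cube n|)%N.
  have -> : (\sum_p mis p = \sum_p \sum_x (hardfun w G x != cand p x))%N.
    by apply: eq_bigr => p _; rewrite /mis -sum1dep_card big_mkcond.
  rewrite exchange_big /= -sum1_card; apply: eq_bigr => x _.
  rewrite -(pair_bigA _ (fun e c => nat_of_bool (hardfun w G x != cand (e, c) x))) /=.
  rewrite !big_bool !ffunE /=.
  by case: (side s _); case: (G _).2; case: (gate_val _ _ _).
have [p misp] : exists p, (4 * mis p <= #|cube n|)%N.
  case: (boolP [exists p, (4 * mis p <= #|cube n|)%N]) => [/existsP //|/existsPn none].
  have lt_mis p : (#|cube n| < 4 * mis p)%N by rewrite ltnNge none.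
  move: mis_sum lt_mis; rewrite -(pair_bigA _ (fun e c => mis (e, c))) !big_bool /=.
  move: #|cube n| => N eN lt_mis.
  have := lt_mis (true, true); have := lt_mis (true, false).
  have := lt_mis (false, true); have := lt_mis (false, false); lia.
apply: le_trans (dist_class_le _ _ (candJ p)) _.
have c0 : 0 < #|cube n|%:R :> R by rewrite ltr0n card_cube expn_gt0.
rewrite /dist ler_pdivrMr // -/(mis p).
by move: misp; rewrite -(ler_nat R) natrM; lra.
Qed.

(** * Random gates, concentration, and the distance of NO functions to juntas *)

Section Weights.
Variable R : realType.
Hypothesis Bl_gt0 : (0 < #|Bl|)%N.
Local Notation h := (#|Bl|%:R : R).

Definition chi s d : R := (-1) ^+ (side s d.1.1 (+) side s d.1.2).
(* The uniform law on gates conditioned on the two inputs lying on the same side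
   ([tau = false]) or on opposite sides ([tau = true]), see [muE]. *)
Definition mu (tau : bool) s d : R := (1 + (-1) ^+ tau * chi s d) / #|gate|%:R.
Definition wt tau s G : R := \prod_z mu tau s (G z).

Lemma h_gt0 : 0 < h. Proof. by rewrite ltr0n. Qed.

Lemma card_gate : #|gate|%:R = 8 * h ^+ 2 :> R.
Proof. by rewrite !card_prod card_bool !natrM; ring. Qed.

Lemma gate_gt0 : 0 < #|gate|%:R :> R.
Proof. by rewrite card_gate mulr_gt0 // exprn_gt0 // h_gt0. Qed.

Lemma muE tau s d :
  mu tau s d = if side s d.1.1 (+) side s d.1.2 == tau then 2 / #|gate|%:R else 0.
Proof.
by rewrite /mu /chi; case: tau; case: (_ (+) _);
  rewrite /= ?expr1 ?expr0 ?mulr1 ?mulrN1 ?opprK ?subrr ?mul0r.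
Qed.

Lemma mu_ge0 tau s d : 0 <= mu tau s d.
Proof. by rewrite muE; case: ifP => // _; rewrite divr_ge0 // ltW // gate_gt0. Qed.

Lemma wt_ge0 tau s G : 0 <= wt tau s G.
Proof. by apply: prodr_ge0 => z _; apply: mu_ge0. Qed.

(** Moving the first input to its partner in the same pair reverses [chi], so [chi] has mean zero
    under uniform gates. *)
Definition swap1 d : gate := ((d.1.1.1, ~~ d.1.1.2), d.1.2, d.2).

Lemma sum_chi s : \sum_d chi s d = 0.
Proof.
have swK : involutive swap1 by move=> [[[b t] u] r]; rewrite /swap1 /= negbK.
have E : \sum_d chi s d = - \sum_d chi s d.
  rewrite [LHS](reindex_inj (inv_inj swK)) /= -sumrN; apply: eq_bigr => d _.
  by rewrite /chi /side /= !addNb signrN.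
lra.
Qed.

Lemma sum_mu tau s : \sum_d mu tau s d = 1.
Proof.
rewrite -mulr_suml big_split /= -mulr_sumr sum_chi mulr0 addr0 sumr_const.
by rewrite divff // gt_eqF // gate_gt0.
Qed.

Lemma sum_wt tau s : \sum_G wt tau s G = 1.
Proof. exact: sum_ffun_prod (sum_mu tau s). Qed.

Lemma wt_side tau s G :
  wt tau s G != 0 -> forall z, side s (G z).1.1 (+) side s (G z).1.2 = tau.
Proof.
move=> /prodf_neq0 wz z; apply/eqP; move: (wz z isT).
by rewrite muE; case: ifP => //; rewrite eqxx.
Qed.

Lemma key_fiber_le w z :
  #|[set y | key w y == z]|%:R <= (2 ^+ #|ctrl w|)^-1 * #|cube n|%:R :> R.
Proof.
rewrite mulrC ler_pdivlMr ?exprn_gt0 // -natrX -natrM ler_nat.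
exact: card_key_fiber.
Qed.

Definition sgn w G (x : cube n) : R := (-1) ^+ hardfun w G x.

(** Toggling the random bit of the gate preserves [mu] and negates the sign. *)
Lemma sum_mu_sign tau s w x : \sum_d mu tau s d * (-1) ^+ gate_val w d x = 0.
Proof.
pose sw d : gate := (d.1, ~~ d.2).
have swK : involutive sw by move=> [? ?]; rewrite /sw /= negbK.
set S := \sum_d _.
have E : S = - S.
  rewrite {1}/S (reindex_inj (inv_inj swK)) /= -sumrN; apply: eq_bigr => d _.
  by rewrite /gate_val /= addNb signrN mulrN.
lra.
Qed.

(** Flipping a control coordinate leads to another cell, hence to an independent gate with an
    unbiased value. The products at two points are thus uncorrelated unless certain of their cells
    coincide, and a cell has density at most 2^(-|ctrl w|). *)
Lemma ctrl_correlation tau s w c c' (eps : R) : 0 < eps ->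
  c \in ctrl w -> c != c' ->
  \sum_(G : {ffun cube n -> gate} | eps * #|cube n|%:R <= `|\sum_x sgn w G (flip c x) * sgn w G (flip c' x)|)
     wt tau s G <= 2 / 2 ^+ #|ctrl w| / eps ^+ 2.
Proof.
move=> eps0 cw cc'.
apply: (@chebyshev_sparse _ _ _ (wt tau s)
  (fun x G => sgn w G (flip c x) * sgn w G (flip c' x))
  (fun x x' => (key w (flip c x') == key w (flip c x)) ||
               (key w (flip c' x') == key w (flip c x)))) => //.
- by rewrite card_cube expn_gt0.
- by move=> G; exact: wt_ge0.
- exact: sum_wt.
- by move=> x G; rewrite normrM !normr_sign mulr1.
- move=> x x'; rewrite negb_or => /andP[far1 far2].
  have far3 : key w (flip c' x) != key w (flip c x).
    apply/eqP => /ffunP/(_ c); rewrite !ffunE cw eqxx (negPf cc') /=.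
    by case: (x c).
  transitivity (\sum_(G : {ffun cube n -> gate}) (\prod_z mu tau s (G z)) *
     \prod_(x <- [:: flip c x; flip c' x; flip c x'; flip c' x'])
        (-1) ^+ gate_val w (G (key w x)) x).
    by apply: eq_bigr => G _; rewrite !big_cons big_nil /sgn ![hardfun _ _ _]ffunE mulr1 -!mulrA.
  rewrite (sum_ffun_prod_keyed _ _ (fun x d => (-1) ^+ gate_val w d x)).
  (* Of the four points only [flip c x] lies in its cell, so this cell contributes the zero mean of
     one gate value. *)
  rewrite (bigD1 (key w (flip c x))) //= [X in X * _](_ : _ = 0) ?mul0r //.
  rewrite -[RHS](sum_mu_sign tau s w (flip c x)); apply: eq_bigr => d _.
  by rewrite !big_cons big_nil eqxx (negPf far1) (negPf far2) (negPf far3) mulr1.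
move=> x.
have fib i : #|[set y | key w (flip i y) == key w (flip c x)]|%:R <=
    (2 ^+ #|ctrl w|)^-1 * #|cube n|%:R :> R.
  have -> : [set y | key w (flip i y) == key w (flip c x)] =
      flip i @^-1: [set y | key w y == key w (flip c x)].
    by apply/setP => y; rewrite !inE.
  rewrite card_preimset; first exact: key_fiber_le.
  exact/inv_inj/flip_involutive.
have -> : [set y | (key w (flip c y) == key w (flip c x)) ||
      (key w (flip c' y) == key w (flip c x))] =
    [set y | key w (flip c y) == key w (flip c x)] :|:
    [set y | key w (flip c' y) == key w (flip c x)].
  by apply/setP => y; rewrite !inE.
apply: (@le_trans _ _ (#|[set y | key w (flip c y) == key w (flip c x)]|%:R +
    #|[set y | key w (flip c' y) == key w (flip c x)]|%:R)).
  by rewrite -natrD ler_nat leq_card_setU.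
by have := fib c; have := fib c'; rewrite -mulrA; lra.
Qed.

(** Of the 4h^2 ordered pairs of inputs half are compatible with [tau], and these are equally
    likely, whence the mean 1/(2h^2); distinct cells have independent gates. *)
Lemma edge_count tau s w uu (eps : R) : 0 < eps ->
  side s uu.1 (+) side s uu.2 = tau ->
  \sum_(G : {ffun cube n -> gate} | eps * #|cube n|%:R <=
      `|\sum_x (((G (key w x)).1 == uu)%:R - (2 * h ^+ 2)^-1)|)
     wt tau s G <= (2 ^+ #|ctrl w|)^-1 / eps ^+ 2.
Proof.
move=> eps0 uut; set p := (2 * h ^+ 2)^-1.
have p01 : 0 <= p <= 1.
  have h1 : 1 <= h ^+ 2 by rewrite exprn_ege1 // ler1n.
  by rewrite invr_ge0 mulr_ge0 ?sqr_ge0 //= invf_le1; lra.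
have mean : \sum_d mu tau s d * ((d.1 == uu)%:R - p) = 0.
  transitivity (\sum_d mu tau s d * (d.1 == uu)%:R - \sum_d mu tau s d * p).
    by rewrite -sumrB; apply: eq_bigr => d _; rewrite mulrBr.
  rewrite -mulr_suml sum_mu mul1r.
  rewrite -(pair_bigA _ (fun v r => mu tau s (v, r) * (v == uu)%:R)) /=.
  rewrite (bigD1 uu) //= [X in _ + X - _]big1 ?addr0; last first.
    by move=> v /negPf vu; rewrite big1 // => r _; rewrite vu mulr0.
  rewrite big_bool !muE /= uut !eqxx mulr1 card_gate /p.
  by field; rewrite gt_eqF // h_gt0.
apply: (@chebyshev_sparse _ _ _ (wt tau s)
  (fun x G => ((G (key w x)).1 == uu)%:R - p)
  (fun x y => key w y == key w x)) => //.
- by rewrite card_cube expn_gt0.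
- by move=> G; exact: wt_ge0.
- exact: sum_wt.
- by move=> x G; rewrite ler_norml; case: (_ == _) => /=; lra.
- move=> x y far.
  transitivity (\sum_(G : {ffun cube n -> gate}) (\prod_z mu tau s (G z)) *
     \prod_(x <- [:: x; y]) (((G (key w x)).1 == uu)%:R - p)).
    by apply: eq_bigr => G _; rewrite !big_cons big_nil mulr1.
  rewrite (sum_ffun_prod_keyed _ _ (fun _ d => (d.1 == uu)%:R - p)).
  rewrite (bigD1 (key w x)) //= [X in X * _](_ : _ = 0) ?mul0r //.
  rewrite -[RHS]mean; apply: eq_bigr => d _.
  by rewrite !big_cons big_nil eqxx (negPf far) mulr1.
by move=> x; exact: key_fiber_le.
Qed.

Lemma card_opposite_pairs s (P : {set Bl * bool}) :
  #|[set uu | [&& uu.1 \in P, uu.2 \in P & side s uu.1 (+) side s uu.2]]| =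
  (2 * (#|[set u in P | side s u == false]| * #|[set u in P | side s u == true]|))%N.
Proof.
set P0 := [set u in P | _]; set P1 := [set u in P | _].
have -> : [set uu | [&& uu.1 \in P, uu.2 \in P & side s uu.1 (+) side s uu.2]] =
    setX P0 P1 :|: setX P1 P0.
  apply/setP => -[u v]; rewrite !inE /=.
  by case: (u \in P); case: (v \in P); case: (side s u); case: (side s v).
rewrite cardsU !cardsX.
have -> : setX P0 P1 :&: setX P1 P0 = set0.
  apply/setP => -[u v]; rewrite !inE /=.
  by case: (u \in P); case: (v \in P); case: (side s u); case: (side s v).
by rewrite cards0 subn0 [(#|P1| * _)%N]mulnC addnn mul2n.
Qed.

Lemma sum_mismatch (f g : boolfun n) :
  2 * #|[set x | f x != g x]|%:R =
  #|cube n|%:R - \sum_x (-1) ^+ f x * (-1) ^+ g x :> R.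
Proof.
rewrite -sum1dep_card -(sum1_card (cube n)) big_mkcond !natr_sum mulr_sumr -sumrB /=.
by apply: eq_bigr => x _; case: (f x); case: (g x); rewrite /= ?expr1 ?expr0; ring.
Qed.

(** [g] is invariant under 16 control flips, so its correlation with the hard function equals that
    with the average of 16 nearly uncorrelated shifts, which is small in mean square. *)
Lemma far_of_many_ctrl w G (g : boolfun n) (D : {set 'I_n}) :
  (forall c c', c \in D -> c' \in D -> c != c' ->
    `|\sum_x sgn w G (flip c x) * sgn w G (flip c' x)| <= 1 / 20 * #|cube n|%:R) ->
  #|D| = 16%N -> {in D, forall c, ~~ depends_on g c} ->
  5 / 16 * #|cube n|%:R < #|[set x | hardfun w G x != g x]|%:R :> R.
Proof.
move=> corr D16 Dg; set N : R := #|cube n|%:R in corr *.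
have N0 : 0 < N by rewrite ltr0n card_cube expn_gt0.
have := sum_mismatch (hardfun w G) g; rewrite -/N.
set S := \sum_x _ => SE.
pose q x : R := \sum_(c in D) sgn w G (flip c x).
have S16 : 16 * S = \sum_x (-1) ^+ g x * q x.
  transitivity (\sum_(c in D) S); first by rewrite sumr_const D16 mulr_natl.
  transitivity (\sum_(c in D) \sum_x (-1) ^+ g x * sgn w G (flip c x)).
    apply: eq_bigr => c cD; rewrite /S (reindex_inj (inv_inj (flip_involutive c))) /=.
    by apply: eq_bigr => x _; rewrite (flip_indep _ (Dg _ cD)) mulrC.
  by rewrite exchange_big; apply: eq_bigr => x _; rewrite mulr_sumr.
(* 28 = 16 + 16 * 15 / 20, from the diagonal terms and the bound on the correlations. *)
have q2 : \sum_x q x ^+ 2 <= 28 * N.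
  have -> : \sum_x q x ^+ 2 =
      \sum_(c in D) \sum_(c' in D) \sum_x sgn w G (flip c x) * sgn w G (flip c' x).
    transitivity (\sum_x \sum_(c in D) \sum_(c' in D)
        sgn w G (flip c x) * sgn w G (flip c' x)).
      apply: eq_bigr => x _; rewrite expr2 mulr_suml.
      by apply: eq_bigr => c _; rewrite mulr_sumr.
    by rewrite exchange_big; apply: eq_bigr => c _; rewrite exchange_big.
  apply: (@le_trans _ _ (\sum_(c in D) 28 / 16 * N)); last first.
    by rewrite sumr_const D16 -mulr_natl; lra.
  apply: ler_sum => c cD; rewrite (bigD1 c) //=.
  have -> : \sum_x sgn w G (flip c x) * sgn w G (flip c x) = N.
    rewrite /N -sum1_card natr_sum; apply: eq_bigr => x _.
    by rewrite -expr2 sqrr_sign.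
  have : \sum_(c' in D | c' != c)
      \sum_x sgn w G (flip c x) * sgn w G (flip c' x) <=
      \sum_(c' in D | c' != c) 1 / 20 * N.
    apply: ler_sum => c' /andP[c'D c'c]; apply: le_trans (ler_norm _) _.
    by apply: corr => //; rewrite eq_sym.
  have -> : \sum_(c' in D | c' != c) 1 / 20 * N = 15 * (1 / 20 * N).
    rewrite sumr_const mulr_natl; congr (_ *+ _).
    have := cardsD1 c D; rewrite cD D16 add1n => -[->].
    by apply: eq_card => c'; rewrite !inE andbC.
  lra.
(* AM-GM: [+-q <= q^2 / 8 + 2]. *)
have : \sum_x (-1) ^+ g x * q x <= \sum_x (q x ^+ 2 / 8 + 2).
  apply: ler_sum => x _.
  by case: (g x); rewrite ?expr1 ?expr0; have := sqr_ge0 (q x / 4 - 1);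
    have := sqr_ge0 (q x / 4 + 1); nra.
(* This yields S <= 11/32 N, hence mismatch density at least 21/64 > 5/16. *)
rewrite big_split /= -mulr_suml sumr_const -mulr_natr -/N -S16.
lra.
Qed.

(** Flipping a forgotten input of a gate with inputs on opposite sides negates the hard function but
    not [g], so at least half of the points with such a gate are mismatches. If about half of the
    active coordinates are forgotten, about 3/4 of the points or more have such a gate. *)
Lemma far_of_few_ctrl w s G (g : boolfun n) (S : {set Bl * bool}) m :
  (forall uu, side s uu.1 (+) side s uu.2 ->
    `|\sum_x (((G (key w x)).1 == uu)%:R - (2 * h ^+ 2)^-1)| <=
      (20 * h ^+ 2)^-1 * #|cube n|%:R) ->
  {in S, forall u, ~~ depends_on g (avar w u)} ->
  (#|Bl| <= #|S| + m)%N -> (100 * m <= #|Bl|)%N ->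
  5 / 16 * #|cube n|%:R < #|[set x | hardfun w G x != g x]|%:R :> R.
Proof.
move=> cnt Sg leS lem; set N : R := #|cube n|%:R in cnt *.
have N0 : 0 < N by rewrite ltr0n card_cube expn_gt0.
have cst (a : R) : \sum_(x : cube n) a = a * N.
  by rewrite sumr_const -[LHS]mulr_natr; congr (_ * _%:R); apply: eq_card.
pose hit d := (side s d.1.1 (+) side s d.1.2) && ((d.1.1 \in S) || (d.1.2 \in S)).
pose H := [set x | hit (G (key w x))].
(* For [x] in [H] this is a forgotten input of its gate; being active, it leaves the key unchanged,
   so flipping it is an involution of [H]. *)
pose pos x := let d := G (key w x) in avar w (if d.1.1 \in S then d.1.1 else d.1.2).
have keypos x : key w (flip (pos x) x) = key w x.
  by apply: key_flip; apply: avar_notin_ctrl.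
have HM : (#|H| <= 2 * #|[set x | hardfun w G x != g x]|)%N.
  apply: (@card_mismatch_involution _ _ _ _ (fun x => flip (pos x) x)) => x.
  - by rewrite !inE keypos.
  - by move=> _; rewrite /pos keypos flip_involutive.
  - rewrite inE /hit => /andP[diff _]; rewrite ![hardfun _ _ _]ffunE keypos /gate_val.
    (* With equal inputs the flip would cancel in the XOR. *)
    have uv : (G (key w x)).1.1 != (G (key w x)).1.2.
      by apply: contraTneq diff => ->; rewrite addbb.
    rewrite /pos /=; case: ifP => _; rewrite flip_eq flip_neq ?(inj_eq (@avar_inj w)) //.
    + by rewrite addNb addbN.
    + by rewrite eq_sym.
    + by rewrite !addbN.
  - rewrite inE /hit => /andP[_ inS]; apply: flip_indep; rewrite /pos /=.
    by apply: Sg; case: ifP inS.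
pose A := [set uu | (side s uu.1 (+) side s uu.2) && ((uu.1 \in S) || (uu.2 \in S))].
have Hge : #|A|%:R * (9 / 20 * h ^- 2 * N) <= #|H|%:R :> R.
  have -> : #|H|%:R = \sum_(uu in A) \sum_x ((G (key w x)).1 == uu)%:R :> R.
    rewrite exchange_big /= -sum1dep_card natr_sum big_mkcond /=.
    apply: eq_bigr => x _.
    have -> : hit (G (key w x)) = ((G (key w x)).1 \in A) by rewrite inE.
    case: ifP => inA.
      rewrite (bigD1 (G (key w x)).1) //= eqxx big1 ?addr0 // => uu /andP[_ /negPf].
      by rewrite eq_sym => ->.
    rewrite big1 // => uu uuA; case: eqP => // eu; by rewrite eu uuA in inA.
  rewrite mulr_natl -sumr_const; apply: ler_sum => uu.
  rewrite inE => /andP[/cnt + _]; rewrite sumrB cst ler_norml => /andP[+ _].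
  have -> : (20 * h ^+ 2)^-1 = 1 / 20 * h ^- 2 by field; rewrite gt_eqF // h_gt0.
  have -> : (2 * h ^+ 2)^-1 = 1 / 2 * h ^- 2 by field; rewrite gt_eqF // h_gt0.
  lra.
have Acard : (2 * (#|Bl| * #|Bl|) <= #|A| + 2 *
    (#|[set u in ~: S | side s u == false]| * #|[set u in ~: S | side s u == true]|))%N.
  rewrite -card_opposite_pairs.
  have -> : (2 * (#|Bl| * #|Bl|) = #|[set uu | [&& uu.1 \in [set: Bl * bool],
      uu.2 \in [set: Bl * bool] & side s uu.1 (+) side s uu.2]]|)%N.
    rewrite card_opposite_pairs; congr (2 * (_ * _))%N;
      [rewrite -(card_side s false)|rewrite -(card_side s true)];
      by apply: eq_card => u; rewrite !inE.
  apply: leq_trans (leq_card_setU _ _); apply: subset_leq_card.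
  apply/subsetP => uu; rewrite !inE /= => ->.
  by case: (uu.1 \in S); case: (uu.2 \in S).
have Csum : (#|[set u in ~: S | side s u == false]| +
    #|[set u in ~: S | side s u == true]| + #|S| = 2 * #|Bl|)%N.
  have -> : (2 * #|Bl| = #|{: Bl * bool}|)%N by rewrite card_prod card_bool mulnC.
  rewrite -(cardsC S) addnC; congr (_ + _)%N.
  rewrite -[RHS](cardsID [set u | side s u == false]); congr (_ + _)%N;
    by apply: eq_card => u; rewrite !inE; case: (side s u); rewrite ?andbF ?andbT.
move: Acard Csum HM Hge; set a0 := #|[set u in ~: S | _]|.
set a1 := #|[set u in ~: S | _]|; set M := #|[set x | _]|.
rewrite -!(ler_nat R) natrD !natrM => Acard /(congr1 (fun k => k%:R : R)) /=.
rewrite natrM !natrD => Csum HM Hge.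
move: leS lem; rewrite -!(ler_nat R) natrD natrM => leS lem.
have h0 := h_gt0.
(* At most 101/100 h active coordinates are kept, and AM-GM bounds the product of the two side
   counts. *)
have a01 : a0%:R * a1%:R <= 13 / 50 * h ^+ 2 :> R.
  have sum_le : a0%:R + a1%:R <= 101 / 100 * h :> R by lra.
  have := sqr_ge0 (a0%:R - a1%:R : R).
  have : 0 <= a0%:R :> R by [].
  have : 0 <= a1%:R :> R by [].
  nra.
(* 37/25 = 2 - 2 * 13/50, and each pair in [A] has density at least (1/2 - 1/20) / h^2. *)
have Ah : 37 / 25 * h ^+ 2 <= #|A|%:R :> R by nra.
have : 37 / 25 * h ^+ 2 * (9 / 20 * h ^- 2 * N) <= 2 * M%:R.
  apply: le_trans HM; apply: le_trans Hge; rewrite ler_wpM2r //.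
  by rewrite !mulr_ge0 ?invr_ge0 ?exprn_ge0 // ltW.
have -> : 37 / 25 * h ^+ 2 * (9 / 20 * h ^- 2 * N) = 37 / 25 * (9 / 20) * N.
  by field; rewrite gt_eqF.
lra.
Qed.

(** Either [g] ignores 16 control coordinates, or it spends its budget [k] on all but 15 of them and
    must forget at least |Bl| - r - 15 active ones. *)
Lemma hard_opposite_far w s G k r (g : boolfun n) :
  (forall uu, side s uu.1 (+) side s uu.2 ->
    `|\sum_x (((G (key w x)).1 == uu)%:R - (2 * h ^+ 2)^-1)| <=
      (20 * h ^+ 2)^-1 * #|cube n|%:R) ->
  (forall c c', c \in ctrl w -> c' \in ctrl w -> c != c' ->
    `|\sum_x sgn w G (flip c x) * sgn w G (flip c' x)| <= 1 / 20 * #|cube n|%:R) ->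
  (k + #|Bl| <= 2 * #|Ch| * #|Bl| + r)%N -> (100 * (r + 15) <= #|Bl|)%N ->
  g \in juntas n k -> 5 / 16 < dist R (hardfun w G) g.
Proof.
move=> cnt corr hk hr; rewrite inE gt_distE; set J := [set i | depends_on g i] => Jk.
have notJ i : i \notin J -> ~~ depends_on g i by rewrite inE.
have [few|/card_geqP[D [uD D16 DJ]]] := ltnP #|ctrl w :\: J| 16; last first.
  apply: (@far_of_many_ctrl _ _ _ [set c in D]).
  - move=> c c'; rewrite !inE => /DJ + /DJ; rewrite !inE => /andP[_ cw] /andP[_ c'w].
    exact: corr.
  - by rewrite cardsE; move/card_uniqP: uD => ->.
  - by move=> c; rewrite inE => /DJ; rewrite inE => /andP[/notJ].
apply: (@far_of_few_ctrl w s G g [set u | avar w u \notin J] (r + 15) cnt) => //.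
  by move=> u; rewrite inE => /notJ.
set S := [set u | _].
have cover : var @: [set: Bl * Ch * bool] \subset
    J :|: (ctrl w :\: J) :|: [set avar w u | u in S].
  apply/subsetP => _ /imsetP[[[b c] t] _ ->]; rewrite !in_setU !in_setD.
  case: (boolP (var (b, c, t) \in J)) => //= vJ.
  have [cw|cw] := eqVneq c (w b); last first.
    by apply/orP; left; apply: imset_f; rewrite inE.
  apply/orP; right; apply/imsetP; exists (b, t); last by rewrite cw.
  by rewrite inE /avar /= -cw.
have := subset_leq_card cover; rewrite card_imset // cardsT !card_prod card_bool.
move=> /leq_trans/(_ (leq_card_setU _ _)) le1.
have le2 : (#|J :|: (ctrl w :\: J)| <= #|J| + #|ctrl w :\: J|)%N by exact: leq_card_setU.
have le3 : (#|[set avar w u | u in S]| <= #|S|)%N by exact: leq_imset_card.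
move: Jk few le1 le2 le3 hk; clear.
move: #|_ :|: _| #|J| #|ctrl w :\: J| #|[set avar w u | u in S]| #|S|.
by move: #|Bl| #|Ch| => *; lia.
Qed.

(** Union bound over 4h^2 pairs of inputs, each failing with probability at most 400 h^4 / 2^|ctrl
    w|, and over pairs of control coordinates, each failing with probability at most 800 / 2^|ctrl
    w|. *)
Lemma hard_opposite_far_pr w s k r :
  (k + #|Bl| <= 2 * #|Ch| * #|Bl| + r)%N -> (100 * (r + 15) <= #|Bl|)%N ->
  \sum_(G | ~~ (5 / 16 < dist_class R (hardfun w G) (juntas n k))) wt true s G <=
  (1600 * h ^+ 6 + 800 * #|ctrl w|%:R ^+ 2) / 2 ^+ #|ctrl w|.
Proof.
move=> hk hr; have h0 := h_gt0.
set N : R := #|cube n|%:R.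
pose ev1 uu G := (side s uu.1 (+) side s uu.2) && ((20 * h ^+ 2)^-1 * N <=
    `|\sum_x (((G (key w x)).1 == uu)%:R - (2 * h ^+ 2)^-1)|).
pose ev2 cc G := [&& cc.1 \in ctrl w, cc.2 \in ctrl w, cc.1 != cc.2 &
    1 / 20 * N <= `|\sum_x sgn w G (flip cc.1 x) * sgn w G (flip cc.2 x)|].
pose ev (i : (Bl * bool) * (Bl * bool) + 'I_n * 'I_n) G :=
  match i with inl uu => ev1 uu G | inr cc => ev2 cc G end.
apply: le_trans (@sum_union_le R _ _ (wt true s) _ ev (wt_ge0 true s) _) _.
  move=> G notfar; apply/existsP; apply: contraNT notfar => /existsPn none.
  apply: lt_dist_class; first by lra.
  move=> g; apply: (hard_opposite_far (s := s) _ _ hk hr) => [uu suu|c c' cw c'w cc'].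
    have := none (inl uu); rewrite /= /ev1 suu /= -ltNge => /ltW; exact.
  have := none (inr (c, c')); rewrite /= /ev2 /= cw c'w cc' /= -ltNge => /ltW; exact.
have P0 : 0 < 2 ^+ #|ctrl w| :> R by rewrite exprn_gt0.
rewrite big_sumType /= [leRHS]mulrDl; apply: lerD.
  apply: (@le_trans _ _ (\sum_(uu : (Bl * bool) * (Bl * bool))
      (400 * h ^+ 4 / 2 ^+ #|ctrl w|))); last first.
    rewrite sumr_const !card_prod card_bool -[leLHS]mulr_natr !natrM.
    rewrite le_eqVlt; apply/orP; left; apply/eqP; field.
    by rewrite gt_eqF.
  apply: ler_sum => uu _; rewrite /ev1.
  case: (boolP (side s uu.1 (+) side s uu.2)) => suu /=; last first.
    by rewrite big_pred0 // divr_ge0 ?mulr_ge0 ?exprn_ge0 // ltW.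
  have e0 : 0 < (20 * h ^+ 2)^-1 by rewrite invr_gt0 mulr_gt0 // exprn_gt0.
  apply: le_trans (edge_count w e0 suu) _.
  rewrite le_eqVlt; apply/orP; left; apply/eqP; field.
  by rewrite !gt_eqF.
apply: (@le_trans _ _ (\sum_(cc : 'I_n * 'I_n | (cc.1 \in ctrl w) && (cc.2 \in ctrl w))
    (800 / 2 ^+ #|ctrl w|))); last first.
  rewrite sumr_const -[leLHS]mulr_natr.
  have -> : #|[pred cc : 'I_n * 'I_n | (cc.1 \in ctrl w) && (cc.2 \in ctrl w)]| =
      #|setX (ctrl w) (ctrl w)| by apply: eq_card => cc; rewrite !inE.
  rewrite cardsX natrM le_eqVlt; apply/orP; left; apply/eqP; field.
  by rewrite gt_eqF.
rewrite [leRHS]big_mkcond /=; apply: ler_sum => -[c c'] _; rewrite /ev2 /=.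
case: (boolP (c \in ctrl w)) => cw /=; last by rewrite big_pred0.
case: (boolP (c' \in ctrl w)) => c'w /=; last by rewrite big_pred0.
case: (boolP (c != c')) => cc' /=; last by rewrite big_pred0 // divr_ge0 // ltW.
have e0 : 0 < 1 / 20 :> R by lra.
apply: le_trans (ctrl_correlation true s e0 cw cc') _.
rewrite le_eqVlt; apply/orP; left; apply/eqP; field.
by rewrite gt_eqF.
Qed.

(** * Indistinguishability *)

Section Queries.
Variables (w : {ffun Bl -> Ch}) (q : nat) (Q : q.-tuple (cube n)).
Variable V : q.-tuple bool -> bool.

Definition acc tau s : R :=
  \sum_(G : {ffun cube n -> gate}) wt tau s G * (V (map_tuple (hardfun w G) Q))%:R.

(** The set L_z: only active coordinates in these blocks can distinguish the queries of cell [z]. *)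
Definition live_blocks (z : cube n) : {set Bl} :=
  [set b | [exists i, exists j, [&& key w (tnth Q i) == z, key w (tnth Q j) == z &
     [exists t, tnth Q i (avar w (b, t)) != tnth Q j (avar w (b, t))]]]].

Definition live z d := (d.1.1.1 \in live_blocks z) && (d.1.2.1 \in live_blocks z).

(** The answers gate [d] gives in cell [z], padded with [false] at queries of other cells; the
    answer to a query is read off the response of its own cell. *)
Definition response z d : {ffun 'I_q -> bool} :=
  [ffun i => (key w (tnth Q i) == z) && gate_val w d (tnth Q i)].

Lemma dead_block_eq z b t i j : b \notin live_blocks z ->
  key w (tnth Q i) = z -> key w (tnth Q j) = z ->
  tnth Q i (avar w (b, t)) = tnth Q j (avar w (b, t)).
Proof.
rewrite inE => /existsPn/(_ i)/existsPn/(_ j) dead iz jz.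
move: dead; rewrite iz jz eqxx /= => /existsPn/(_ t).
by rewrite negbK => /eqP.
Qed.

(* Moving an endpoint within a dead block changes every answer of the cell by the
   same amount, which the output bit of the gate absorbs; [chi] changes sign. *)
Lemma sum_chi_dead1 s z e (P : pred Bl) :
  \sum_(d | [&& response z d == e, d.1.1.1 \notin live_blocks z & P d.1.2.1])
     chi s d = 0.
Proof.
pose x0 : cube n := if [pick i | key w (tnth Q i) == z] is Some i then tnth Q i
  else [ffun=> false].
pose iota d : gate := ((d.1.1.1, ~~ d.1.1.2), d.1.2,
  d.2 (+) (x0 (avar w d.1.1) (+) x0 (avar w (d.1.1.1, ~~ d.1.1.2)))).
have iotaK : involutive iota.
  move=> [[[b t] u] r]; rewrite /iota /= negbK; congr (_, _, _).
  by rewrite [x0 _ (+) x0 (avar w (b, t))]addbC addbK.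
have resp d : d.1.1.1 \notin live_blocks z -> response z (iota d) = response z d.
  move=> dead; apply/ffunP => i; rewrite !ffunE; case: eqP => //= iz.
  have x0E t : x0 (avar w (d.1.1.1, t)) = tnth Q i (avar w (d.1.1.1, t)).
    rewrite /x0; case: pickP => [j /eqP jz|/(_ i)]; last by rewrite iz eqxx.
    exact: dead_block_eq dead jz iz.
  move: dead x0E; case: d => [[[b t] u] r] /= _ x0E.
  rewrite /gate_val /= !x0E.
  by case: r; case: (tnth Q i _); case: (tnth Q i _); case: (tnth Q i _).
set S := \sum_(d | _) _.
have E : S = - S.
  rewrite {1}/S (reindex_inj (inv_inj iotaK)) /= -sumrN.
  apply: eq_big => [d|d _].
    case: (boolP (d.1.1.1 \in live_blocks z)) => dead; first by rewrite !andbF.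
    by rewrite resp.
  by rewrite /chi /side /= !addNb signrN.
lra.
Qed.

(** Exchanging the two inputs reduces this to a dead first input. *)
Lemma sum_chi_dead2 s z e (P : pred Bl) :
  \sum_(d | [&& response z d == e, d.1.2.1 \notin live_blocks z & P d.1.1.1])
     chi s d = 0.
Proof.
pose sw d : gate := (d.1.2, d.1.1, d.2).
have swK : involutive sw by move=> [[u v] r].
rewrite (reindex_inj (inv_inj swK)) /= -[RHS](sum_chi_dead1 s z e P).
apply: eq_big => [d|d _]; last by rewrite /chi addbC.
congr (_ && _); congr (_ == _); apply/ffunP => i.
by rewrite !ffunE /gate_val /= [X in _ (+) X]addbC.
Qed.

(** [mu] with the bias erased on gates having an input in a dead block. *)
Definition live_wt tau s z d : R :=
  (1 + (-1) ^+ tau * ((live z d)%:R * chi s d)) / #|gate|%:R.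

Lemma sum_live_wt tau s z e :
  \sum_(d | response z d == e) mu tau s d =
  \sum_(d | response z d == e) live_wt tau s z d.
Proof.
rewrite -!mulr_suml !big_split /= -!mulr_sumr; congr ((_ + _ * _) / _).
rewrite [LHS](bigID (live z)) /= [X in _ + X](_ : _ = 0) ?addr0.
  rewrite [RHS](bigID (live z)) /= [X in _ + X]big1 ?addr0; last first.
    by move=> d /andP[_ /negPf ->]; rewrite mul0r.
  by apply: eq_bigr => d /andP[_ ->]; rewrite mul1r.
(* A gate that is not live has a dead first input, or a live first and a dead second one. *)
rewrite (bigID (fun d => d.1.1.1 \in live_blocks z)) /=.
rewrite [X in X + _](_ : _ = 0) ?[X in _ + X](_ : _ = 0) ?addr0 //.
  rewrite -[RHS](sum_chi_dead1 s z e predT); apply: eq_bigl => d; rewrite /live.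
  by case: (_ == e); case: (d.1.1.1 \in _); case: (d.1.2.1 \in _).
rewrite -[RHS](sum_chi_dead2 s z e (fun b => b \in live_blocks z)).
apply: eq_bigl => d; rewrite /live.
by case: (_ == e); case: (d.1.1.1 \in _); case: (d.1.2.1 \in _).
Qed.

(** The verdict sees [G] only through the responses of the cells, to which [mu] and [live_wt] give
    equal weights. *)
Lemma acc_live tau s :
  acc tau s = \sum_(G : {ffun cube n -> gate}) (\prod_z live_wt tau s z (G z)) *
    (V (map_tuple (hardfun w G) Q))%:R.
Proof.
pose Phi (r : {ffun cube n -> {ffun 'I_q -> bool}}) : R :=
  (V [tuple r (key w (tnth Q i)) i | i < q])%:R.
have PhiE G : (V (map_tuple (hardfun w G) Q))%:R = Phi [ffun z => response z (G z)].
  congr ((V _)%:R); apply: eq_from_tnth => i.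
  by rewrite tnth_map tnth_mktuple !ffunE eqxx.
rewrite /acc; under eq_bigr do rewrite PhiE; under [RHS]eq_bigr do rewrite PhiE.
exact: sum_ffun_prod_fiber (sum_live_wt tau s).
Qed.

(** Two positions for each input and two random bits give 8 gates per ordered pair of blocks,
    cancelling the 8 in the number of gates. *)
Lemma sum_live s z :
  \sum_d (1 + (live z d)%:R * ((-1) ^+ s d.1.1.1 * (-1) ^+ s d.1.2.1)) / #|gate|%:R =
  1 + (\sum_(b in live_blocks z) (-1) ^+ s b / h) ^+ 2 :> R.
Proof.
rewrite -mulr_suml big_split /= sumr_const mulrDl divff ?gt_eqF ?gate_gt0 //.
congr (_ + _).
pose F b : R := (b \in live_blocks z)%:R * (-1) ^+ s b.
have -> : \sum_d (live z d)%:R * ((-1) ^+ s d.1.1.1 * (-1) ^+ s d.1.2.1) =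
    \sum_(d : gate) F d.1.1.1 * F d.1.2.1.
  by apply: eq_bigr => d _; rewrite /F /live -mulnb natrM; ring.
have sum2 (I : finType) (f : I -> R) : \sum_(p : I * bool) f p.1 = 2 * \sum_i f i.
  rewrite -(pair_bigA _ (fun i (t : bool) => f i)) /= mulr_sumr.
  by apply: eq_bigr => i _; rewrite big_bool /=; ring.
rewrite (sum2 _ (fun uv : (Bl * bool) * (Bl * bool) => F uv.1.1 * F uv.2.1)).
rewrite -(pair_bigA _ (fun u v : Bl * bool => F u.1 * F v.1)) /=.
have -> : \sum_(u : Bl * bool) \sum_(v : Bl * bool) F u.1 * F v.1 = (2 * \sum_b F b) ^+ 2.
  by rewrite -sum2 expr2 mulr_suml; apply: eq_bigr => u _; rewrite mulr_sumr.
have -> : \sum_(b in live_blocks z) (-1) ^+ s b / h = (\sum_b F b) / h.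
  rewrite -mulr_suml big_mkcond; congr (_ / _); apply: eq_bigr => b _.
  by rewrite /F; case: (b \in _); rewrite ?mul1r ?mul0r.
by rewrite card_gate; field; rewrite gt_eqF // h_gt0.
Qed.

(** Relative to uniform gates, [G] has as density a product of factors 1 + k m or 1 - k m, with [m]
    a product of two signs. The domination of sign expansions replaces [k] by |k|, the indicator of
    live gates, and averaging over uniform [G] restores a product over cells. *)
Lemma acc_diff_le :
  `|\sum_s acc false s - \sum_s acc true s| <=
  2 * (\sum_(s : {ffun Bl -> bool}) \prod_z (1 + (\sum_(b in live_blocks z) (-1) ^+ s b / h) ^+ 2)
       - #|{ffun Bl -> bool}|%:R).
Proof.
pose K : R := \prod_(z : cube n) (#|gate|%:R)^-1.
pose k G z : R := (live z (G z))%:R * (-1) ^+ ((G z).1.1.2 (+) (G z).1.2.2).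
pose m G s z : R := (-1) ^+ s (G z).1.1.1 * (-1) ^+ s (G z).1.2.1.
have chiE s G z : (live z (G z))%:R * chi s (G z) = k G z * m G s z.
  by rewrite /k /m /chi /side !signr_addb [X in _ * X = _]mulrACA !mulrA.
have prodE tau s G : \prod_z live_wt tau s z (G z) =
    K * \prod_z (1 + (-1) ^+ tau * (k G z * m G s z)).
  by rewrite /K -big_split; apply: eq_bigr => z _; rewrite /live_wt chiE mulrC.
have K0 : 0 <= K by apply: prodr_ge0 => z _; rewrite invr_ge0.
have -> : \sum_s acc false s - \sum_s acc true s =
    \sum_(G : {ffun cube n -> gate}) K * (V (map_tuple (hardfun w G) Q))%:R *
      \sum_(s : {ffun Bl -> bool}) (\prod_z (1 + k G z * m G s z) - \prod_z (1 - k G z * m G s z)).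
  rewrite -sumrB; transitivity (\sum_(s : {ffun Bl -> bool}) \sum_(G : {ffun cube n -> gate}) K * (V (map_tuple (hardfun w G) Q))%:R *
      (\prod_z (1 + k G z * m G s z) - \prod_z (1 - k G z * m G s z))).
    apply: eq_bigr => s _; rewrite !acc_live -sumrB; apply: eq_bigr => G _.
    rewrite !prodE expr0 expr1; under eq_bigr do rewrite mul1r.
    by under [X in _ - K * X * _]eq_bigr do rewrite mulN1r; ring.
  by rewrite exchange_big; apply: eq_bigr => G _; rewrite mulr_sumr.
apply: le_trans (ler_norm_sum _ _ _) _.
apply: (@le_trans _ _ (\sum_(G : {ffun cube n -> gate}) K * (2 * (\sum_(s : {ffun Bl -> bool}) \prod_z (1 + `|k G z| * m G s z)
    - #|{ffun Bl -> bool}|%:R)))).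
  apply: ler_sum => G _; rewrite !normrM (ger0_norm K0) -mulrA.
  apply: ler_wpM2l => //.
  have := sum_sign_prod_diff (b1 := fun z => (G z).1.1.1) (b2 := fun z => (G z).1.2.1)
    (k G) (m := m G) (fun _ _ => erefl).
  by case: (V _); rewrite ?normr1 ?mul1r // normr0 mul0r => /(le_trans (normr_ge0 _)).
have sumK : \sum_(G : {ffun cube n -> gate}) K = 1.
  apply: (@sum_ffun_prod R (cube n) gate (fun=> (#|gate|%:R)^-1)).
  by rewrite sumr_const -[LHS]mulr_natl divff // gt_eqF // gate_gt0.
under eq_bigr do rewrite mulrCA mulrBr.
rewrite -mulr_sumr sumrB -mulr_suml sumK mul1r ler_pM2l // lerD2r.
under eq_bigr do rewrite mulr_sumr.
rewrite exchange_big /= le_eqVlt; apply/orP; left; apply/eqP.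
apply: eq_bigr => s _; under [RHS]eq_bigr do rewrite -sum_live.
rewrite bigA_distr_bigA; apply: eq_bigr => G _; rewrite /K -big_split.
apply: eq_bigr => z _ /=; rewrite mulrC /k normrM normr_sign mulr1.
by rewrite ger0_norm.
Qed.

End Queries.

(** * Separation of queries by the choice of active pairs *)

Definition blockdiff (x y : cube n) : {set Bl} :=
  [set b | [exists c, exists t, x (var (b, c, t)) != y (var (b, c, t))]].

Lemma key_eq_choice w x y b c t :
  key w x = key w y -> x (var (b, c, t)) != y (var (b, c, t)) -> w b = c.
Proof.
move=> kxy; apply: contraNeq => wbc; move/ffunP/(_ (var (b, c, t))): kxy.
have inw : var (b, c, t) \in ctrl w.
  by apply: imset_f; rewrite inE /= eq_sym.
by rewrite !ffunE inw /= => ->.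
Qed.

(** In a block where [x] and [y] differ, equal keys force the active pair to be one particular pair,
    since a difference anywhere else would show in the key. Each such block costs a factor |Ch|. *)
Lemma card_key_eq x y :
  (#|[set w | key w x == key w y]| * #|Ch| ^ #|blockdiff x y| <= #|{ffun Bl -> Ch}|)%N.
Proof.
pose wit b := [pick c | [exists t, x (var (b, c, t)) != y (var (b, c, t))]].
pose F b : pred Ch := if wit b is Some c then pred1 c else predT.
have sub : [set w | key w x == key w y] \subset
    [set w : {ffun Bl -> Ch} | [forall b, w b \in F b]].
  apply/subsetP => w; rewrite !inE => /eqP kxy; apply/forallP => b.
  rewrite /F /wit; case: pickP => [c /existsP[t xy]|//].
  by rewrite inE; apply/eqP; exact: key_eq_choice xy.
apply: leq_trans (leq_mul (subset_leq_card sub) (leqnn _)) _.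
rewrite card_set_family -prod_nat_const [X in (_ * X)%N]big_mkcond -big_split /=.
rewrite card_ffun -prod_nat_const; apply: leq_prod => b _.
rewrite /F /wit inE; case: pickP => [c cP|none].
  by rewrite card1 mul1n; case: existsP => // -[]; exists c.
case: existsP => [[c]|_]; first by rewrite none.
by rewrite muln1; apply: max_card.
Qed.

Definition spread w q (Q : q.-tuple (cube n)) t :=
  [exists ij : 'I_q * 'I_q, (key w (tnth Q ij.1) == key w (tnth Q ij.2)) &&
     (t < #|blockdiff (tnth Q ij.1) (tnth Q ij.2)|)%N].

Lemma card_spread q (Q : q.-tuple (cube n)) t : (1 < #|Ch|)%N ->
  #|[set w | spread w Q t]|%:R <= q%:R ^+ 2 / 2 ^+ t * #|{ffun Bl -> Ch}|%:R :> R.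
Proof.
move=> Ch2; rewrite -sum1dep_card natr_sum.
pose A (ij : 'I_q * 'I_q) w := (key w (tnth Q ij.1) == key w (tnth Q ij.2)) &&
     (t < #|blockdiff (tnth Q ij.1) (tnth Q ij.2)|)%N.
apply: le_trans (@sum_union_le R _ _ (fun=> 1) _ A _ _) _ => //.
  by move=> w /existsP.
apply: (@le_trans _ _ (\sum_(ij : 'I_q * 'I_q) #|{ffun Bl -> Ch}|%:R / 2 ^+ t)).
  apply: ler_sum => ij _; rewrite /A.
  case: ltnP => far; last first.
    by rewrite big_pred0 ?divr_ge0 ?exprn_ge0 // => w; rewrite andbF.
  rewrite ler_pdivlMr ?exprn_gt0 //.
  apply: le_trans (_ : (#|[set w | key w (tnth Q ij.1) == key w (tnth Q ij.2)]| *
      #|Ch| ^ #|blockdiff (tnth Q ij.1) (tnth Q ij.2)|)%:R <= _); last first.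
    by rewrite ler_nat card_key_eq.
  rewrite natrM -sum1dep_card natr_sum; apply: ler_pM => //.
  - by apply: sumr_ge0.
  - by rewrite exprn_ge0.
  - by rewrite le_eqVlt; apply/orP; left; apply/eqP; apply: eq_bigl => w; rewrite andbT.
  - rewrite -natrX ler_nat; apply: (@leq_trans (#|Ch| ^ t)).
      by case: (t) => // t'; rewrite leq_exp2r.
    by rewrite leq_exp2l // ltnW.
rewrite sumr_const card_prod !card_ord -[leLHS]mulr_natr natrM.
by rewrite le_eqVlt; apply/orP; left; apply/eqP; field; rewrite gt_eqF ?exprn_gt0.
Qed.

Lemma card_bigcup_le (I T : finType) (P : pred I) (F : I -> {set T}) :
  (#|\bigcup_(i | P i) F i| <= \sum_(i | P i) #|F i|)%N.
Proof.
elim/big_rec2: _ => [|i A B _ le]; first by rewrite cards0.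
by apply: leq_trans (leq_card_setU _ _) _; rewrite leq_add2l.
Qed.

(** The differences of the queries of a cell from one reference query cover its live blocks, at most
    [t] per query; summing over cells counts each query once. *)
Lemma sum_live_blocks w q (Q : q.-tuple (cube n)) t : ~~ spread w Q t ->
  (\sum_z #|live_blocks w Q z| <= q * t)%N.
Proof.
move=> /existsPn good.
have cell z : (#|live_blocks w Q z| <= \sum_(i < q | key w (tnth Q i) == z) t)%N.
  case: (pickP (fun i => key w (tnth Q i) == z)) => [i0 /eqP i0z|none]; last first.
    rewrite [live_blocks _ _ _](_ : _ = set0) ?cards0 //; apply/setP => b.
    by rewrite !inE; apply/existsP => -[i /existsP[j]]; rewrite none.
  have sub : live_blocks w Q z \subset
      \bigcup_(i < q | key w (tnth Q i) == z) blockdiff (tnth Q i) (tnth Q i0).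
    apply/subsetP => b; rewrite inE => /existsP[i /existsP[j]].
    move=> /and3P[iz jz /existsP[t' ij]].
    have diff l : key w (tnth Q l) == z ->
        tnth Q l (avar w (b, t')) != tnth Q i0 (avar w (b, t')) ->
        b \in \bigcup_(i < q | key w (tnth Q i) == z) blockdiff (tnth Q i) (tnth Q i0).
      move=> lz l0; apply/bigcupP; exists l => //; rewrite inE.
      by apply/existsP; exists (w b); apply/existsP; exists t'.
    (* If queries [i] and [j] disagree, one of them disagrees with the reference [i0]. *)
    case: (eqVneq (tnth Q i (avar w (b, t'))) (tnth Q i0 (avar w (b, t')))) => [e|];
      last exact: diff.
    by apply: (diff j) => //; rewrite -e eq_sym.
  apply: leq_trans (subset_leq_card sub) (leq_trans (card_bigcup_le _ _) _).
  apply: leq_sum => i /eqP iz; have := good (i, i0).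
  by rewrite /= iz i0z eqxx /= -leqNgt.
apply: (@leq_trans (\sum_z \sum_(i < q | key w (tnth Q i) == z) t)).
  by apply: leq_sum => z _; exact: cell.
rewrite (exchange_big_dep xpredT) //=.
rewrite (eq_bigr (fun=> t)); first by rewrite sum_nat_const card_ord.
by move=> i _; rewrite (big_pred1 (key w (tnth Q i))) // => z; rewrite eq_sym.
Qed.

Lemma acc01 w q (Q : q.-tuple (cube n)) V tau s : 0 <= acc w Q V tau s <= 1.
Proof.
rewrite sumr_ge0 /=; last by move=> G _; rewrite mulr_ge0 // wt_ge0.
rewrite -(sum_wt tau s); apply: ler_sum => G _.
by rewrite ler_piMr ?wt_ge0 //; case: (V _).
Qed.

(** A [w] with [spread] is charged the trivial gap 1; for any other, the live blocks number at most
    q t <= eta h^2 in total. *)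
Lemma acc_gap q (Q : q.-tuple (cube n)) V t (eta : R) : (1 < #|Ch|)%N ->
  (q * t)%:R <= eta * h ^+ 2 -> 32 * eta <= 1 ->
  \sum_w \sum_s acc w Q V false s - \sum_w \sum_s acc w Q V true s <=
  #|{ffun Bl -> Ch}|%:R * #|{ffun Bl -> bool}|%:R *
    (q%:R ^+ 2 / 2 ^+ t + 2 * (expR (2 * eta) - 1)).
Proof.
move=> Ch2 qt eta1; set W : R := #|{ffun Bl -> Ch}|%:R.
set S : R := #|{ffun Bl -> bool}|%:R.
have eta0 : 0 <= eta.
  have := le_trans (ler0n R _) qt; rewrite pmulr_lge0 // exprn_gt0 //.
  exact: h_gt0.
have e1 : 1 <= expR (2 * eta).
  by apply: le_trans (expR_ge1Dx _); rewrite lerDl mulr_ge0.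
have S0 : 0 <= S by [].
rewrite -sumrB.
apply: (@le_trans _ _ (\sum_w (S * (spread w Q t)%:R + S * (2 * (expR (2 * eta) - 1))))).
  apply: ler_sum => w _; case: (boolP (spread w Q t)) => [_|good].
    apply: (@le_trans _ _ S); last by rewrite mulr1 lerDl !mulr_ge0 // subr_ge0.
    rewrite -sumrB /S -sum1_card natr_sum; apply: ler_sum => s _.
    have := acc01 w Q V false s; have := acc01 w Q V true s; lra.
  rewrite mulr0 add0r; apply: le_trans (ler_norm _) _.
  apply: le_trans (acc_diff_le _ _ _) _.
  have le1 := sum_prod_sign_le (L := live_blocks w Q) h_gt0 _ eta1.
  rewrite mulrCA ler_pM2l // mulrBr mulr1 lerD2r; apply: le1.
  apply: le_trans qt; rewrite -natr_sum ler_nat; exact: sum_live_blocks.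
have cst (a : R) : \sum_(w : {ffun Bl -> Ch}) a = a * W.
  by rewrite sumr_const -[LHS]mulr_natr; congr (_ * _%:R); apply: eq_card.
rewrite big_split /= -mulr_sumr cst.
have := card_spread Q t Ch2; rewrite -sum1dep_card big_mkcond natr_sum /= -/W => sp.
have -> : \sum_w (spread w Q t)%:R = \sum_w (if spread w Q t then 1%N else 0%N)%:R :> R.
  by apply: eq_bigr => w _; case: (spread _ _ _).
rewrite [leRHS]mulrDr; apply: lerD; last by rewrite [leLHS]mulrC [leLHS]mulrA lexx.
by rewrite [W * S]mulrC -mulrA ler_wpM2l // mulrC.
Qed.

(** Yao's principle: on average the tester accepts YES functions with probability at least 2/3 and
    NO functions with at most 1/3 + p, while the gap is bounded for every seed. *)
Lemma tester_gap q (T : nonadaptive_tester R n q) k t (eta p : R) : (1 < #|Ch|)%N ->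
  is_tolerant_tester (1 / 4) (5 / 16) (juntas n k) T ->
  (2 * #|Ch| * #|Bl| <= k + #|Bl|)%N ->
  (forall w s, \sum_(G | ~~ (5 / 16 < dist_class R (hardfun w G) (juntas n k)))
     wt true s G <= p) ->
  (q * t)%:R <= eta * h ^+ 2 -> 32 * eta <= 1 ->
  1 / 3 <= p + (q%:R ^+ 2 / 2 ^+ t + 2 * (expR (2 * eta) - 1)).
Proof.
move=> Ch2 tol hk far qt eta1.
have W0 : 0 < #|{ffun Bl -> Ch}|%:R :> R by rewrite ltr0n card_ffun expn_gt0 ltnW.
have S0 : 0 < #|{ffun Bl -> bool}|%:R :> R by rewrite ltr0n card_ffun card_bool expn_gt0.
have acE f : accept_pr T f = \sum_(sd : seed T) seed_pr sd * (accepts f sd)%:R.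
  rewrite /accept_pr big_mkcond; apply: eq_bigr => sd _.
  by case: (accepts f sd); rewrite ?mulr1 ?mulr0.
have rej0 f : 0 <= reject_pr T f by apply: sumr_ge0 => sd _; exact: seed_pr_ge0.
pose E tau : R := \sum_w \sum_s \sum_G wt tau s G * accept_pr T (hardfun w G).
have EE tau : E tau = \sum_(sd : seed T) seed_pr sd *
    \sum_w \sum_s acc w (queries sd) (verdict sd) tau s.
  transitivity (\sum_w \sum_s \sum_G \sum_(sd : seed T)
      seed_pr sd * (wt tau s G * (accepts (hardfun w G) sd)%:R)).
    apply: eq_bigr => w _; apply: eq_bigr => s _; apply: eq_bigr => G _.
    by rewrite acE mulr_sumr; apply: eq_bigr => sd _; rewrite mulrCA.
  transitivity (\sum_(sd : seed T) \sum_w \sum_s \sum_G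
      seed_pr sd * (wt tau s G * (accepts (hardfun w G) sd)%:R)).
    rewrite [RHS]exchange_big; apply: eq_bigr => w _.
    rewrite [RHS]exchange_big; apply: eq_bigr => s _.
    by rewrite [RHS]exchange_big.
  apply: eq_bigr => sd _; rewrite mulr_sumr; apply: eq_bigr => w _.
  by rewrite mulr_sumr; apply: eq_bigr => s _; rewrite mulr_sumr.
have cst (a : R) : \sum_(w : {ffun Bl -> Ch}) \sum_(s : {ffun Bl -> bool}) a =
    #|{ffun Bl -> Ch}|%:R * #|{ffun Bl -> bool}|%:R * a.
  rewrite !sumr_const -[LHS]mulr_natl -[X in _ * X]mulr_natl mulrA.
  by congr (_%:R * _%:R * _); apply: eq_card.
have Elow : #|{ffun Bl -> Ch}|%:R * #|{ffun Bl -> bool}|%:R * (2 / 3) <= E false.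
  rewrite -cst; apply: ler_sum => w _; apply: ler_sum => s _.
  have -> : 2 / 3 = \sum_G wt false s G * (2 / 3) by rewrite -mulr_suml sum_wt mul1r.
  apply: ler_sum => G _.
  have [->|wt0] := eqVneq (wt false s G) 0; first by rewrite !mul0r.
  apply: ler_wpM2l; first exact: wt_ge0.
  have [close _] := tol (hardfun w G); apply: close.
  apply: (@hard_same_side_close R w s G k _ hk) => z.
  by have := wt_side wt0 z; case: (side _ _); case: (side _ _).
have Ehigh : E true <= #|{ffun Bl -> Ch}|%:R * #|{ffun Bl -> bool}|%:R * (1 / 3 + p).
  rewrite -cst; apply: ler_sum => w _; apply: ler_sum => s _.
  apply: (@le_trans _ _ (\sum_G (wt true s G * (1 / 3) +
     (if ~~ (5 / 16 < dist_class R (hardfun w G) (juntas n k)) then wt true s G else 0)))).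
    apply: ler_sum => G _; have w0 := wt_ge0 true s G.
    have := accept_reject T (hardfun w G); have := rej0 (hardfun w G); have := (tol (hardfun w G)).2.
    case: (5 / 16 < _) => /= tolG r0 ar; first by have := tolG isT; nra.
    by nra.
  rewrite big_split /= -mulr_suml sum_wt mul1r -big_mkcond lerD2l; exact: far.
have gap : E false - E true <= #|{ffun Bl -> Ch}|%:R * #|{ffun Bl -> bool}|%:R *
    (q%:R ^+ 2 / 2 ^+ t + 2 * (expR (2 * eta) - 1)).
  rewrite !EE -sumrB; set D := leRHS.
  have -> : D = \sum_(sd : seed T) seed_pr sd * D by rewrite -mulr_suml seed_pr_sum1 mul1r.
  apply: ler_sum => sd _; rewrite -mulrBr; apply: ler_wpM2l; first exact: seed_pr_ge0.
  exact: acc_gap.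
have WS : 0 < #|{ffun Bl -> Ch}|%:R * #|{ffun Bl -> bool}|%:R :> R by rewrite mulr_gt0.
rewrite -(ler_pM2l WS); lra.
Qed.

End Weights.
End HardFunctions.

(** * The lower bound *)

Definition parity n : boolfun n := [ffun x : cube n => \big[addb/false]_(i < n) x i].

Lemma parity_flip n i (x : cube n) : parity n (flip i x) = ~~ parity n x.
Proof.
rewrite !ffunE (bigD1 i) //= flip_eq addNb; congr (~~ _).
rewrite [RHS](bigD1 i) //=; congr (_ (+) _).
by apply: eq_bigr => j ji; rewrite flip_neq.
Qed.

(** Without queries all functions are accepted with equal probability, yet the zero function is a
    junta and parity is far from every [k]-junta. This serves for small [k]. *)
Lemma tester_queries_gt0 (R : realType) n k q (T : nonadaptive_tester R n q) :
  (k < n)%N -> is_tolerant_tester (1 / 4) (5 / 16) (juntas n k) T -> (0 < q)%N.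
Proof.
move=> kn tol; rewrite lt0n; apply/eqP => q0; subst q.
have acc_eq f g : accept_pr T f = accept_pr T g.
  apply: eq_bigl => sd; rewrite /accepts; congr (verdict _ _).
  by rewrite [LHS]tuple0 [RHS]tuple0.
pose f0 : boolfun n := [ffun=> false].
have c0 : 0 < #|cube n|%:R :> R by rewrite ltr0n card_cube expn_gt0.
have close : dist_class R f0 (juntas n k) <= 1 / 4.
  have f0J : f0 \in juntas n k.
    rewrite inE (_ : [set i | _] = set0) ?cards0 //; apply/setP => i.
    by rewrite !inE; apply/existsP => -[x]; rewrite !ffunE.
  apply: le_trans (dist_class_le _ _ f0J) _.
  rewrite /dist (_ : [set x | _] = set0) ?cards0 ?mul0r //; first by lra.
  by apply/setP => x; rewrite !inE eqxx.
have far : 5 / 16 < dist_class R (parity n) (juntas n k).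
  apply: lt_dist_class => [|g]; first by lra.
  rewrite inE gt_distE; set J := [set i | depends_on g i] => Jk.
  have [i iJ] : exists i, i \notin J.
    apply/existsP; apply: contraTT kn => /existsPn allJ; rewrite -leqNgt.
    apply: leq_trans Jk; rewrite -[X in (X <= _)%N]card_ord -cardsT.
    by apply: subset_leq_card; apply/subsetP => i _; have := allJ i; rewrite negbK.
  have := @card_mismatch_involution n (parity n) g [set: cube n] (flip i).
  rewrite cardsT => mis.
  have : (#|cube n| <= 2 * #|[set x | parity n x != g x]|)%N.
    apply: mis => x _; rewrite ?flip_involutive ?parity_flip ?inE //.
    by apply: flip_indep; move: iJ; rewrite inE.
  by rewrite -(ler_nat R) natrM; lra.
have := accept_reject T (parity n); rewrite (acc_eq _ f0).
have := (tol f0).1 close; have := (tol (parity n)).2 far; lra.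
Qed.

Lemma exists_injective_ord (T : finType) n :
  (#|T| <= n)%N -> exists f : T -> 'I_n, injective f.
Proof.
move=> Tn; exists (fun x => widen_ord Tn (enum_rank x)) => x y.
by move=> /(congr1 val) /= /val_inj /enum_rank_inj.
Qed.

Lemma pow6_le_pow4 (R : realFieldType) m :
  (64 <= m)%N -> 48 * 1000 * m%:R ^+ 6 <= 4 ^+ m :> R.
Proof.
elim: m => // m IH; rewrite leq_eqVlt => /orP[/eqP <-|]; first by lra.
rewrite ltnS => m64; have {}IH := IH m64.
have m0 : 64 <= m%:R :> R by rewrite ler_nat.
(* The induction step works because (5/4)^6 < 4. *)
have : m.+1%:R <= 5 / 4 * m%:R :> R by rewrite -natr1; lra.
move=> le1; have le6 : m.+1%:R ^+ 6 <= (5 / 4 * m%:R) ^+ 6 :> R.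
  by rewrite ler_pXn2r // nnegrE ?ler0n //; lra.
have mm : 0 <= m%:R ^+ 6 :> R by rewrite exprn_ge0.
rewrite exprMn in le6; rewrite (exprS 4 m); lra.
Qed.

(** As 2m <= c <= 2m^2, the numerator is at most 4800 m^6, and 48000 m^6 <= 4^m <= 2^c. *)
Lemma ctrl_bound (R : realFieldType) (b m c : nat) :
  (64 <= m)%N -> (2 <= b <= m)%N -> (c + 2 * m = 2 * b * m)%N ->
  (1600 * m%:R ^+ 6 + 800 * c%:R ^+ 2) / 2 ^+ c <= 1 / 10 :> R.
Proof.
move=> m64 /andP[b2 bm] cE.
have c_ge : (2 * m <= c)%N by nia.
have c_le : (c <= 2 * m ^ 2)%N by rewrite -mulnn; nia.
have m6 := pow6_le_pow4 R m64.
have : 4 ^+ m <= 2 ^+ c :> R.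
  have -> : 4 = 2 ^+ 2 :> R by rewrite expr2; lra.
  by rewrite -exprM ler_weXn2l // ler1n.
move=> p4; rewrite ler_pdivrMr ?exprn_gt0 //.
have : c%:R ^+ 2 <= 4 * m%:R ^+ 6 :> R.
  have m1 : 1 <= m%:R :> R by rewrite ler1n (leq_trans _ m64).
  have : c%:R ^+ 2 <= (2 * m%:R ^+ 2) ^+ 2 :> R.
    rewrite ler_pXn2r ?nnegrE ?ler0n ?mulr_ge0 ?exprn_ge0 //.
    by rewrite -natrX -natrM ler_nat.
  move=> /le_trans; apply; rewrite exprMn -exprM.
  have : m%:R ^+ 4 <= m%:R ^+ 6 :> R by rewrite ler_weXn2l.
  rewrite /=; lra.
lra.
Qed.

Lemma up_log2_le (R : realType) (k : nat) :
  (1 < k)%N -> (up_log 2 k)%:R <= 1 + ln (k%:R ^+ 2) :> R.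
Proof.
move=> k1; have k0 : 0 < k%:R :> R by rewrite ltr0n ltnW.
have /andP[lo _] := up_log_bounds (isT : (1 < 2)%N) k1.
(* From exp(1/2) <= 1 / (1 - 1/2) = 2. *)
have ln2 : 1 / 2 <= ln 2 :> R.
  rewrite -ler_expR lnK ?posrE //.
  have half1 : 1 / 2 < 1 :> R by lra.
  by have := expR_le_invB half1; rewrite -[X in _ <= X]mul1r ler_pdivlMr; lra.
have : 2 ^+ (up_log 2 k).-1 <= k%:R :> R by rewrite -natrX ler_nat ltnW.
rewrite -ler_ln ?posrE ?exprn_gt0 // !lnXn //.
rewrite -[ln 2 *+ _]mulr_natl -[ln k%:R *+ 2]mulr_natl => le1.
have -> : (up_log 2 k)%:R = (up_log 2 k).-1%:R + 1 :> R.
  by rewrite natr1 prednK // up_log_gt0.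
have : 0 <= (up_log 2 k).-1%:R :> R by [].
nra.
Qed.

(** The construction has [m = k %/ (2 * b).-1] blocks of [b] pairs, so that the junta size (2b - 1)
    m equals [k] up to rounding. Too few queries would contradict the gap. *)
Lemma junta_tester_lower_bound (R : realType) (b n k q : nat)
    (T : nonadaptive_tester R n q) :
  (2 <= b)%N -> (100 * (2 * b + 13) <= k %/ (2 * b).-1)%N ->
  (2 * b * (k %/ (2 * b).-1) <= n)%N ->
  is_tolerant_tester (1 / 4) (5 / 16) (juntas n k) T ->
  k%:R ^+ 2 / Num.max 1 (ln (k%:R ^+ 2)) <= 60 * 100 * b%:R ^+ 2 * q%:R :> R.
Proof.
set m := (k %/ _)%N => b2 mb bmn tol; rewrite leNgt; apply/negP => small.
set M := Num.max 1 _ in small.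
have M1 : 1 <= M by rewrite le_max lexx.
have M0 : 0 < M by apply: lt_le_trans M1.
have ML : ln (k%:R ^+ 2) <= M by rewrite le_max lexx orbT.
have kE := divn_eq k (2 * b).-1; have kr : (k %% (2 * b).-1 < (2 * b).-1)%N.
  by rewrite ltn_pmod //; lia.
rewrite -/m in kE.
have m_gt0 : (0 < m)%N by lia.
have k_le : (k <= 2 * b * m)%N by nia.
have k_ge : (2 * b * m <= k + m)%N by nia.
have k_gap : (k + m <= 2 * b * m + (2 * b).-2)%N by nia.
have k1 : (1 < k)%N by nia.
have m64 : (64 <= m)%N by lia.
have b2m : (2 <= b <= m)%N by lia.
have mr : (100 * ((2 * b).-2 + 15) <= m)%N by lia.
have [var var_inj] : exists var : 'I_m * 'I_b * bool -> 'I_n, injective var.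
  by apply: exists_injective_ord; rewrite !card_prod !card_ord card_bool; lia.
(* Ensures 2^t >= 128 k^4 >= 128 q^2. *)
pose t := (7 + 4 * up_log 2 k)%N.
have t_le : t%:R <= 15 * M :> R.
  by have := up_log2_le R k1; rewrite natrD natrM; lra.
have k0 : 0 < k%:R :> R by rewrite ltr0n ltnW.
have b0 : 2 <= b%:R :> R by rewrite ler_nat.
have qM : 60 * 100 * b%:R ^+ 2 * q%:R * M < k%:R ^+ 2 by rewrite -ltr_pdivlMr.
have q_le : q%:R <= k%:R ^+ 2 :> R.
  apply: le_trans (ltW qM); rewrite -mulrAC ler_peMl //.
  have : 1 <= 60 * 100 * b%:R ^+ 2 :> R by nra.
  nra.
have qt : q%:R ^+ 2 / 2 ^+ t <= 1 / 128 :> R.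
  have : k%:R <= 2 ^+ up_log 2 k :> R.
    by rewrite -natrX ler_nat; have /andP[] := up_log_bounds (isT : (1 < 2)%N) k1.
  rewrite -(ler_pXn2r (isT : (0 < 4)%N)) ?nnegrE ?exprn_ge0 // -exprM mulnC => k4.
  rewrite ler_pdivrMr ?exprn_gt0 // exprD.
  have : q%:R ^+ 2 <= (k%:R ^+ 2) ^+ 2 :> R by rewrite ler_pXn2r ?nnegrE ?exprn_ge0.
  by rewrite -exprM; lra.
have := @tester_gap n 'I_m 'I_b var var_inj R _ q T k t (1 / 100) (1 / 10) _ tol.
rewrite !card_ord => gap.
(* The right-hand side is at most 1/10 + 1/128 + 2/49, which is below 1/3. *)
have {gap} : 1 / 3 <= 1 / 10 + (q%:R ^+ 2 / 2 ^+ t + 2 * (expR (2 * (1 / 100)) - 1)) :> R.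
  apply: gap => // [w s||]; last by lra.
    have cE := card_ctrl var_inj w; rewrite (card_ord m) (card_ord b) in cE.
    have cb := ctrl_bound R m64 b2m cE.
    have := @hard_opposite_far_pr n 'I_m 'I_b var var_inj R _ w s k (2 * b).-2.
    rewrite (card_ord m) (card_ord b).
    move=> /(_ m_gt0 k_gap mr) far; exact: le_trans far cb.
  have m0 : 0 < m%:R :> R by rewrite ltr0n.
  have kR : k%:R <= 2 * b%:R * m%:R :> R by rewrite -!natrM ler_nat.
  have k2 : k%:R ^+ 2 <= (2 * b%:R * m%:R) ^+ 2 :> R.
    by rewrite ler_pXn2r ?nnegrE ?mulr_ge0.
  (* Altogether q t <= 15 q M <= k^2 / (400 b^2) <= m^2 / 100. *)
  rewrite natrM; apply: (@le_trans _ _ (q%:R * (15 * M))); first by rewrite ler_wpM2l.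
  have bb : 0 < b%:R ^+ 2 :> R by rewrite exprn_gt0 //; lra.
  rewrite -(ler_pM2l bb); rewrite !exprMn in k2; lra.
have lt1 : 2 * (1 / 100) < 1 :> R by lra.
by have := expR_le_invB lt1; rewrite -[X in _ <= X]mul1r ler_pdivlMr; lra.
Qed.

Theorem theorem1p3 (R : realType) :
  exists c : nat,
  forall alpha : R, alpha < 1 ->
  exists eps0 eps1 : R,
    [/\ 0 < eps0, eps0 < eps1, eps1 < 1 &
    exists (C : R) (n0 : nat), 0 < C /\
      forall n k : nat, (n0 <= n)%N -> k%:R <= alpha * n%:R ->
      forall (q : nat) (T : nonadaptive_tester R n q),
        is_tolerant_tester eps0 eps1 (juntas n k) T ->
        C * over_polylog c ((k%:R : R) ^+ 2) <= q%:R].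
Proof.
exists 1%N => alpha alpha1; exists (1 / 4), (5 / 16); split; try lra.
(* Blocks are taken so large that 2b alpha <= 2b - 1, which makes all 2b m coordinates fit into
   [n]. *)
have [b b2 balpha] : exists2 b : nat, (2 <= b)%N & 1 <= 2 * b%:R * (1 - alpha).
  have a0 : 0 < 1 - alpha by lra.
  exists (Num.bound ((1 - alpha)^-1)).+2 => //.
  have := archi_boundP (ltW (_ : 0 < (1 - alpha)^-1)); rewrite invr_gt0 => /(_ a0).
  move=> /ltW; rewrite -[X in X <= _]mul1r ler_pdivrMr // => le1.
  have -> : (Num.bound (1 - alpha)^-1).+2%:R = (Num.bound (1 - alpha)^-1)%:R + 2 :> R.
    by rewrite -addn2 natrD.
  have : 0 <= (Num.bound (1 - alpha)^-1)%:R :> R by [].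
  nra.
have b0 : 2 <= b%:R :> R by rewrite ler_nat.
(* From [K] on there are at least 100 (2b + 13) blocks. *)
pose K := (2 * b * (100 * (2 * b + 13)))%N.
have K1 : 1 <= K%:R :> R by rewrite ler1n /K; nia.
pose D : R := 60 * 100 * b%:R ^+ 2 + K%:R ^+ 2.
have D0 : 0 < D by rewrite addr_gt0 ?mulr_gt0 ?exprn_gt0 //; lra.
exists D^-1, 1%N; split; first by rewrite invr_gt0.
move=> n k n1 kn q T tol; rewrite /over_polylog expr1 mulrC ler_pdivrMr //.
have n0 : 0 < n%:R :> R by rewrite ltr0n.
have ltkn : (k < n)%N by rewrite -(ltr_nat R); nra.
have q1 : 1 <= q%:R :> R by rewrite ler1n; exact: tester_queries_gt0 ltkn tol.
have k0 : 0 <= k%:R :> R by [].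
have b00 : 0 <= b%:R ^+ 2 :> R by rewrite exprn_ge0.
have K0 : 0 <= K%:R ^+ 2 :> R by rewrite exprn_ge0.
(* For [k < K] the claimed bound is at most 1, and a tester makes at least one query. *)
have [kK|Kk] := ltnP k K.
  have M1 : 1 <= Num.max 1 (ln (k%:R ^+ 2)) :> R by rewrite le_max lexx.
  rewrite ler_pdivrMr; last by apply: lt_le_trans M1.
  have : k%:R ^+ 2 <= K%:R ^+ 2 :> R by rewrite ler_pXn2r ?nnegrE // ler_nat ltnW.
  have : D <= q%:R * D by rewrite ler_peMl // ltW.
  have : q%:R * D <= q%:R * D * Num.max 1 (ln (k%:R ^+ 2)).
    by rewrite ler_peMr // mulr_ge0 // ltW.
  rewrite /D; lra.
have mb : (100 * (2 * b + 13) <= k %/ (2 * b).-1)%N.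
  by rewrite leq_divRL; [rewrite /K in Kk; nia|lia].
apply: le_trans (junta_tester_lower_bound b2 mb _ tol) _; last first.
  by rewrite mulrC ler_wpM2l // /D lerDl.
(* The coordinates suffice: (2b - 1) 2b m <= 2b k <= 2b alpha n <= (2b - 1) n. *)
have : ((k %/ (2 * b).-1) * (2 * b).-1 <= k)%N by exact: leq_trunc_div.
set m := (k %/ _)%N => mk.
have mkR : m%:R * (2 * b%:R - 1) <= k%:R :> R.
  have -> : 2 * b%:R - 1 = (2 * b).-1%:R :> R.
    by rewrite -[(2 * b).-1]subn1 natrB ?natrM //; lia.
  by rewrite -natrM ler_nat.
rewrite -(ler_nat R) !natrM.
have m0 : 0 <= m%:R :> R by [].
have bb : 0 < 2 * b%:R - 1 :> R by lra.
rewrite -(ler_pM2l bb).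
have : 2 * b%:R * k%:R <= 2 * b%:R * (alpha * n%:R) by rewrite ler_pM2l //; lra.
have : 2 * b%:R * (m%:R * (2 * b%:R - 1)) <= 2 * b%:R * k%:R :> R by rewrite ler_pM2l //; lra.
have : n%:R <= 2 * b%:R * (1 - alpha) * n%:R by rewrite ler_peMl // ltW.
lra.
Qed.
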